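(* Let $\mathcal C$ be a $C^*$-category. The category $M(\mathcal C)$ having the same objects as $\mathcal C$ and arrows the spaces $M(\rho,\sigma)$ of multipliers, $\rho,\sigma$ objects of $\mathcal C$, is a unital $C^*$-category. Moreover, the maps $(\rho,\sigma)\ni t\mapsto M_t\in M(\rho,\sigma)$ induce a $C^*$-monofunctor $I:\mathcal C\hookrightarrow M(\mathcal C)$, in such a way that $I(\mathcal C)$ is an essential ideal of $M(\mathcal C)$. If $\mathcal C$ is unital, then $I(\mathcal C)=M(\mathcal C)$. If $\mathcal C$ is an essential ideal of a unital $C^*$-category $\mathcal C'$, then there exists a $C^*$-monofunctor $I':\mathcal C'\hookrightarrow M(\mathcal C)$ extending $I$.
   Context: A $C^*$-category $\mathcal C$ is a category, not necessarily with identity arrows, in which every set of arrows $(\rho,\sigma)$ (arrows from $\rho$ to $\sigma$) is a complex Banach space, composition $(t',t)\mapsto t'\circ t$ ($t\in(\rho,\sigma)$, $t'\in(\sigma,\tau)$) is bilinear with $\|t'\circ t\|\le\|t'\|\|t\|$, together with an antilinear isometric involutive contravariant functor $*$ which is the identity on objects, such that $\|t^*\circ t\|=\|t\|^2$ and $t^*\circ t$ is a positive element of the $C^*$-algebra $(\rho,\rho)$ for every $t\in(\rho,\sigma)$. $\mathcal C$ is unital if every object $\rho$ has an identity arrow $1_\rho\in(\rho,\rho)$. A $C^*$-functor is a functor preserving this structure (linear on arrow spaces and $*$-preserving, and unital when dealing with unital categories mapped to unital ones); it is a $C^*$-monofunctor if it is injective on every space of arrows. A multiplier from $\rho$ to $\sigma$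 is a pair $T=(T^l,T^r)$, where $T^l:(\rho,\rho)\to(\rho,\sigma)$ is a bounded linear map with $T^l(a\circ a')=T^l(a)\circ a'$, $T^r:(\sigma,\sigma)\to(\rho,\sigma)$ is a bounded linear map with $T^r(b'\circ b)=b'\circ T^r(b)$, and $b\circ T^l(a)=T^r(b)\circ a$ for all $a\in(\rho,\rho)$, $b\in(\sigma,\sigma)$. $M(\rho,\sigma)$ is the set of multipliers from $\rho$ to $\sigma$. Notation: $Ta:=T^l(a)$, $bT:=T^r(b)$; one has $\|T^l\|=\|T^r\|$, and this number is $\|T\|$. For $t\in(\rho,\sigma)$, $M_t\in M(\rho,\sigma)$ is defined by $M_ta:=t\circ a$, $bM_t:=b\circ t$. The identity multiplier $1_\rho\in M(\rho,\rho)$ is $1_\rho a=a1_\rho:=a$. The involution $M(\rho,\sigma)\to M(\sigma,\rho)$, $T\mapsto T^*$, is $T^*b:=(b^*T)^*$, $aT^*:=(Ta^* )^*$ for $b\in(\sigma,\sigma)$, $a\in(\rho,\rho)$. For $S\in M(\sigma,\tau)$, $t\in(\rho,\sigma)$ put $St:=\lim_\lambda(Se_\lambda)\circ t\in(\rho,\tau)$, and for $t'\in(\sigma,\tau)$, $T\in M(\rho,\sigma)$ put $t'T:=\lim_\lambda t'\circ(e_\lambda T)\in(\rho,\tau)$, where $(e_\lambda)$ is an approximate unit of $(\sigma,\sigma)$ (these norm limits exist and do not depend on the approximate unit). The composition $M(\sigma,\tau)\times M(\rho,\sigma)\to M(\rho,\tau)$ is $(S\circ T)a:=S(Ta)$,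 $c(S\circ T):=(cS)T$ for $a\in(\rho,\rho)$, $c\in(\tau,\tau)$. An ideal $\mathcal I$ of a $C^*$-category $\mathcal C$ is a $C^*$-subcategory (closed, $*$-stable arrow spaces $(\rho,\sigma)_{\mathcal I}\subseteq(\rho,\sigma)$) with the same objects such that $t\circ t'\in(\tau,\sigma)_{\mathcal I}$ and $t''\circ t\in(\rho,\xi)_{\mathcal I}$ for all $t\in(\rho,\sigma)_{\mathcal I}$, $t'\in(\tau,\rho)$, $t''\in(\sigma,\xi)$. The ideal $\mathcal I$ is essential if for every nonzero ideal $\mathcal J$ of $\mathcal C$ there are objects $\rho,\sigma$ with $(\rho,\sigma)_{\mathcal I}\cap(\rho,\sigma)_{\mathcal J}\ne\{0\}$. *)

(* Defs.v *)
From HB Require Import structures.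
From mathcomp Require Import all_boot all_order all_algebra.
From mathcomp Require Import mathcomp_extra boolp classical_sets functions.
From mathcomp Require Import reals topology normedtype.
From mathcomp Require Import complex.

Set Implicit Arguments.
Unset Strict Implicit.
Unset Printing Implicit Defensive.

Import Order.TTheory GRing.Theory Num.Theory.
Import numFieldNormedType.Exports.

Local Open Scope classical_set_scope.
Local Open Scope ring_scope.

(* Composition is written in the usual order: for t from rho to sigma and s
   from sigma to tau, [acomp s t] is s o t. No identity arrows are required. *)
Record cstarData (R : realType) (Ob : Type) := CstarData {
  arrow : Ob -> Ob -> normedModType R[i];
  acomp : forall rho sigma tau : Ob,
    arrow sigma tau -> arrow rho sigma -> arrow rho tau;
  astar : forall rho sigma : Ob, arrow rho sigma -> arrow sigma rho
}.

Arguments acomp {R Ob D rho sigma tau} s t : rename.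
Arguments astar {R Ob D rho sigma} t : rename.

Definition positive_arrow (R : realType) (Ob : Type) (D : cstarData R Ob)
    (rho : Ob) (a : arrow D rho rho) : Prop :=
  exists b : arrow D rho rho, a = acomp (astar b) b.

(* The norm of a [normedModType R[i]] takes its values in the nonnegative
   reals, seen inside R[i]. *)
Record is_cstar_category (R : realType) (Ob : Type) (D : cstarData R Ob) :
    Prop := IsCstarCategory {
  arrow_complete : forall (rho sigma : Ob) (F : set_system (arrow D rho sigma)),
    ProperFilter F -> cauchy F -> cvg F;
  acomp_linear_right : forall (rho sigma tau : Ob) (s : arrow D sigma tau),
    linear (fun t : arrow D rho sigma => acomp s t);
  acomp_linear_left : forall (rho sigma tau : Ob) (t : arrow D rho sigma),
    linear (fun s : arrow D sigma tau => acomp s t);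
  acompA : forall (rho sigma tau upsilon : Ob)
    (r : arrow D tau upsilon) (s : arrow D sigma tau) (t : arrow D rho sigma),
    acomp r (acomp s t) = acomp (acomp r s) t;
  acomp_norm : forall (rho sigma tau : Ob)
    (s : arrow D sigma tau) (t : arrow D rho sigma),
    `|acomp s t| <= `|s| * `|t|;
  astar_antilinear : forall (rho sigma : Ob) (k : R[i]) (t u : arrow D rho sigma),
    astar (k *: t + u) = conjc k *: astar t + astar u;
  astar_norm : forall (rho sigma : Ob) (t : arrow D rho sigma), `|astar t| = `|t|;
  astarK : forall (rho sigma : Ob) (t : arrow D rho sigma), astar (astar t) = t;
  astar_comp : forall (rho sigma tau : Ob)
    (s : arrow D sigma tau) (t : arrow D rho sigma),
    astar (acomp s t) = acomp (astar t) (astar s);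
  cstar_identity : forall (rho sigma : Ob) (t : arrow D rho sigma),
    `|acomp (astar t) t| = `|t| ^+ 2;
  astar_comp_positive : forall (rho sigma : Ob) (t : arrow D rho sigma),
    positive_arrow (acomp (astar t) t)
}.

Record cstarCategory (R : realType) (Ob : Type) := CstarCategory {
  cstar_data :> cstarData R Ob;
  cstarP : is_cstar_category cstar_data
}.

Definition is_identity (R : realType) (Ob : Type) (D : cstarData R Ob)
    (rho : Ob) (e : arrow D rho rho) : Prop :=
  (forall (sigma : Ob) (t : arrow D rho sigma), acomp t e = t) /\
  (forall (sigma : Ob) (t : arrow D sigma rho), acomp e t = t).

Definition cstar_unital (R : realType) (Ob : Type) (D : cstarData R Ob) :
    Prop :=
  forall rho : Ob, exists e : arrow D rho rho, is_identity e.

Record is_star_functor (R : realType) (Ob1 Ob2 : Type)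
    (D1 : cstarData R Ob1) (D2 : cstarData R Ob2) (f : Ob1 -> Ob2)
    (F : forall rho sigma : Ob1, arrow D1 rho sigma -> arrow D2 (f rho) (f sigma)) :
    Prop := IsStarFunctor {
  functor_linear : forall rho sigma : Ob1, linear (@F rho sigma);
  functor_comp : forall (rho sigma tau : Ob1)
    (s : arrow D1 sigma tau) (t : arrow D1 rho sigma),
    F _ _ (acomp s t) = acomp (F _ _ s) (F _ _ t);
  functor_star : forall (rho sigma : Ob1) (t : arrow D1 rho sigma),
    F _ _ (astar t) = astar (F _ _ t)
}.

Definition is_cstar_functor (R : realType) (Ob1 Ob2 : Type)
    (D1 : cstarData R Ob1) (D2 : cstarData R Ob2) (f : Ob1 -> Ob2)
    (F : forall rho sigma : Ob1, arrow D1 rho sigma -> arrow D2 (f rho) (f sigma)) :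
    Prop :=
  is_star_functor F /\
  (cstar_unital D1 -> cstar_unital D2 ->
   forall (rho : Ob1) (e : arrow D1 rho rho),
     is_identity e -> is_identity (F _ _ e)).

Definition is_cstar_monofunctor (R : realType) (Ob1 Ob2 : Type)
    (D1 : cstarData R Ob1) (D2 : cstarData R Ob2) (f : Ob1 -> Ob2)
    (F : forall rho sigma : Ob1, arrow D1 rho sigma -> arrow D2 (f rho) (f sigma)) :
    Prop :=
  is_cstar_functor F /\ forall rho sigma : Ob1, injective (@F rho sigma).

Arguments is_star_functor {R Ob1 Ob2} D1 D2 f F.
Arguments is_cstar_functor {R Ob1 Ob2} D1 D2 f F.
Arguments is_cstar_monofunctor {R Ob1 Ob2} D1 D2 f F.

Record is_ideal (R : realType) (Ob : Type) (D : cstarData R Ob)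
    (I : forall rho sigma : Ob, set (arrow D rho sigma)) : Prop := IsIdeal {
  ideal0 : forall rho sigma : Ob, I rho sigma 0;
  ideal_linear : forall (rho sigma : Ob) (k : R[i]) (t u : arrow D rho sigma),
    I rho sigma t -> I rho sigma u -> I rho sigma (k *: t + u);
  ideal_closed : forall rho sigma : Ob, closed (I rho sigma);
  ideal_star : forall (rho sigma : Ob) (t : arrow D rho sigma),
    I rho sigma t -> I sigma rho (astar t);
  ideal_compr : forall (rho sigma tau : Ob)
    (t : arrow D rho sigma) (t' : arrow D tau rho),
    I rho sigma t -> I tau sigma (acomp t t');
  ideal_compl : forall (rho sigma xi : Ob)
    (t : arrow D rho sigma) (t'' : arrow D sigma xi),
    I rho sigma t -> I rho xi (acomp t'' t)
}.

Definition is_essential_ideal (R : realType) (Ob : Type) (D : cstarData R Ob)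
    (I : forall rho sigma : Ob, set (arrow D rho sigma)) : Prop :=
  is_ideal I /\
  forall J : forall rho sigma : Ob, set (arrow D rho sigma),
    is_ideal J ->
    (exists (rho sigma : Ob) (t : arrow D rho sigma), J rho sigma t /\ t <> 0) ->
    exists rho sigma : Ob, I rho sigma `&` J rho sigma <> [set 0].

(* [J] exhibits the C*-category [C] as an essential ideal of [D]: it identifies
   the arrow spaces of [C], with their whole structure (norm included), with
   those of an essential ideal of [D]. *)
Definition is_essential_ideal_inclusion (R : realType) (Ob : Type)
    (C D : cstarData R Ob)
    (J : forall rho sigma : Ob, arrow C rho sigma -> arrow D rho sigma) : Prop :=
  [/\ is_star_functor C D idfun J,
      forall (rho sigma : Ob) (t : arrow C rho sigma), `|J _ _ t| = `|t| &
      is_essential_ideal (fun rho sigma : Ob => range (@J rho sigma))].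

Definition bounded_map (R : realType) (V W : normedModType R[i])
    (f : V -> W) : Prop :=
  exists k : R[i], forall v : V, `|f v| <= k * `|v|.

Record is_multiplier (R : realType) (Ob : Type) (C : cstarCategory R Ob)
    (rho sigma : Ob) (Tl : arrow C rho rho -> arrow C rho sigma)
    (Tr : arrow C sigma sigma -> arrow C rho sigma) : Prop := IsMultiplier {
  multl_linear : linear Tl;
  multl_bounded : bounded_map Tl;
  multl_comp : forall a a' : arrow C rho rho, Tl (acomp a a') = acomp (Tl a) a';
  multr_linear : linear Tr;
  multr_bounded : bounded_map Tr;
  multr_comp : forall b' b : arrow C sigma sigma,
    Tr (acomp b' b) = acomp b' (Tr b);
  mult_middle : forall (a : arrow C rho rho) (b : arrow C sigma sigma),
    acomp b (Tl a) = acomp (Tr b) a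
}.

Section MultiplierSpace.
Context {R : realType} {Ob : Type} (C : cstarCategory R Ob).
Implicit Types rho sigma tau : Ob.

Local Notation funs rho sigma :=
  ((arrow C rho rho -> arrow C rho sigma) *
   (arrow C sigma sigma -> arrow C rho sigma))%type.

Definition multiplier_pred rho sigma : {pred funs rho sigma} :=
  fun T => `[< is_multiplier T.1 T.2 >].

Record multiplier rho sigma := Multiplier {
  multiplier_val : funs rho sigma;
  _ : multiplier_val \in @multiplier_pred rho sigma
}.

HB.instance Definition _ rho sigma :=
  [isSub for @multiplier_val rho sigma].
HB.instance Definition _ rho sigma :=
  [Choice of multiplier rho sigma by <:].

Definition multl rho sigma (T : multiplier rho sigma) := (multiplier_val T).1.
Definition multr rho sigma (T : multiplier rho sigma) := (multiplier_val T).2.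

Lemma multiplierP rho sigma (T : multiplier rho sigma) :
  is_multiplier (multl T) (multr T).
Proof. by case: T => [[l r] h]; exact: (asboolW h). Qed.

Definition mk_multiplier rho sigma Tl Tr
    (h : @is_multiplier R Ob C rho sigma Tl Tr) : multiplier rho sigma :=
  @Multiplier rho sigma (Tl, Tr) (introT (asboolP _) h).

Lemma acompDr rho sigma tau (s : arrow C sigma tau) (t u : arrow C rho sigma) :
  acomp s (t + u) = acomp s t + acomp s u.
Proof.
by have := acomp_linear_right (cstarP C) s 1 t u; rewrite !scale1r.
Qed.

Lemma acomp0r rho sigma tau (s : arrow C sigma tau) :
  acomp s (0 : arrow C rho sigma) = 0.
Proof. by apply: (addrI (acomp s 0)); rewrite -acompDr !addr0. Qed.

Lemma acompZr rho sigma tau k (s : arrow C sigma tau) (t : arrow C rho sigma) :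
  acomp s (k *: t) = k *: acomp s t.
Proof.
by have := acomp_linear_right (cstarP C) s k t 0; rewrite acomp0r !addr0.
Qed.

Lemma acompDl rho sigma tau (s s' : arrow C sigma tau) (t : arrow C rho sigma) :
  acomp (s + s') t = acomp s t + acomp s' t.
Proof.
by have := acomp_linear_left (cstarP C) t 1 s s'; rewrite !scale1r.
Qed.

Lemma acomp0l rho sigma tau (t : arrow C rho sigma) :
  acomp (0 : arrow C sigma tau) t = 0.
Proof. by apply: (addrI (acomp 0 t)); rewrite -acompDl !addr0. Qed.

Lemma acompZl rho sigma tau k (s : arrow C sigma tau) (t : arrow C rho sigma) :
  acomp (k *: s) t = k *: acomp s t.
Proof.
by have := acomp_linear_left (cstarP C) t k s 0; rewrite acomp0l !addr0.
Qed.

Lemma bounded_map_ge0 (V W : normedModType R[i]) (f : V -> W) :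
  bounded_map f -> exists2 k : R[i], 0 <= k & forall v, `|f v| <= k * `|v|.
Proof.
move=> [k hk]; exists `|k| => // v.
have h := hk v; have /normr_idP h0 := le_trans (normr_ge0 _) h.
by rewrite (le_trans h)// -[leLHS]h0 normrM normr_id.
Qed.

Lemma multiplier_submod_closed rho sigma :
  submod_closed (@multiplier_pred rho sigma).
Proof.
split.
  apply/asboolP; split => //=.
  - by move=> k u v; rewrite scaler0 addr0.
  - by exists 0 => v; rewrite normr0 mul0r.
  - by move=> a a'; rewrite acomp0l.
  - by move=> k u v; rewrite scaler0 addr0.
  - by exists 0 => v; rewrite normr0 mul0r.
  - by move=> b b'; rewrite acomp0r.
  - by move=> a b; rewrite acomp0l acomp0r.
have bdd (V W : normedModType R[i]) k (f g : V -> W) :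
    bounded_map f -> bounded_map g -> bounded_map (k *: f + g).
  move=> /bounded_map_ge0[p p0 fp] /bounded_map_ge0[q q0 gq].
  exists (`|k| * p + q) => v.
  rewrite (le_trans (ler_normD _ _))// mulrDl lerD// normrZ -mulrA.
  exact: ler_wpM2l.
have lin (V W : normedModType R[i]) k (f g : V -> W) :
    linear f -> linear g -> linear (k *: f + g).
  move=> hf hg c u v.
  have E w : (k *: f + g) w = k *: f w + g w by [].
  rewrite !E hf hg !scalerDr !scalerA [k * c]mulrC addrACA.
  by rewrite -!addrA.
move=> k [l r] [l' r'] /asboolP[/= h1 h2 h3 h4 h5 h6 h7].
move=> /asboolP[/= g1 g2 g3 g4 g5 g6 g7].
apply/asboolP; split => /=.
- exact: lin.
- exact: bdd.
- by move=> a a'; rewrite acompDl acompZl -h3 -g3.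
- exact: lin.
- exact: bdd.
- by move=> b' b; rewrite acompDr acompZr -h6 -g6.
- by move=> a b; rewrite acompDl acompDr acompZl acompZr h7 g7.
Qed.

HB.instance Definition _ rho sigma :=
  GRing.isSubmodClosed.Build R[i] _ (@multiplier_pred rho sigma)
    (@multiplier_submod_closed rho sigma).
HB.instance Definition _ rho sigma :=
  [SubChoice_isSubLmodule of multiplier rho sigma by <:].

(* ||T|| is the operator norm of T^l, which equals that of T^r. *)
Definition multiplier_rnorm rho sigma (T : multiplier rho sigma) : R :=
  sup [set complex.Re `|multl T a| | a in [set a | `|a| <= 1]].

Definition multiplier_norm rho sigma (T : multiplier rho sigma) : R[i] :=
  (multiplier_rnorm T)%:C%C.

Lemma Re_normK (V : normedModType R[i]) (v : V) :
  (complex.Re `|v|)%:C%C = `|v|.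
Proof. exact/RRe_real/ger0_real/normr_ge0. Qed.

Lemma Re_cnormK (k : R[i]) : (complex.Re `|k|)%:C%C = `|k|.
Proof. exact/RRe_real/ger0_real/normr_ge0. Qed.

Lemma le_Re (x y : R[i]) : x <= y -> complex.Re x <= complex.Re y.
Proof. by rewrite lecE => /andP[]. Qed.

Lemma multiplier_has_sup rho sigma (T : multiplier rho sigma) :
  has_sup [set complex.Re `|multl T a| | a in [set a | `|a| <= 1]].
Proof.
split; first by exists (complex.Re `|multl T 0|), 0 => //=; rewrite normr0.
have /bounded_map_ge0[k k0 hk] := multl_bounded (multiplierP T).
exists (complex.Re k) => _ [a /= a1 <-]; apply: le_Re.
by rewrite (le_trans (hk a))// ler_piMr.
Qed.

Lemma multiplier_rnorm_ub rho sigma (T : multiplier rho sigma) a :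
  `|a| <= 1 -> complex.Re `|multl T a| <= multiplier_rnorm T.
Proof.
by move=> a1; apply: (sup_upper_bound (multiplier_has_sup T)); exists a.
Qed.

Lemma multiplier_rnorm_le rho sigma (T : multiplier rho sigma) (r : R) :
  (forall a, `|a| <= 1 -> complex.Re `|multl T a| <= r) ->
  multiplier_rnorm T <= r.
Proof.
move=> h; apply: ge_sup; first by case: (multiplier_has_sup T).
by move=> _ [a /= a1 <-]; exact: h.
Qed.

Lemma multlD rho sigma (T S : multiplier rho sigma) a :
  multl (T + S) a = multl T a + multl S a.
Proof. by []. Qed.

Lemma multlZ rho sigma k (T : multiplier rho sigma) a :
  multl (k *: T) a = k *: multl T a.
Proof. by []. Qed.

Lemma multiplier_normD rho sigma (T S : multiplier rho sigma) :
  multiplier_norm (T + S) <= multiplier_norm T + multiplier_norm S.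
Proof.
rewrite -rmorphD/= lecR; apply: multiplier_rnorm_le => a a1.
rewrite multlD (le_trans (le_Re (ler_normD _ _)))// raddfD/=.
by apply: lerD; exact: multiplier_rnorm_ub.
Qed.

Lemma multiplier_norm_ge0 rho sigma (T : multiplier rho sigma) :
  0 <= multiplier_norm T.
Proof.
rewrite ler0c; apply: (le_trans _ (@multiplier_rnorm_ub _ _ T 0 _)).
  by rewrite -(raddf0 (@complex.Re R)); exact/le_Re/normr_ge0.
by rewrite normr0.
Qed.

Lemma multiplier_normZ rho sigma k (T : multiplier rho sigma) :
  multiplier_norm (k *: T) = `|k| * multiplier_norm T.
Proof.
have leZ c (S : multiplier rho sigma) :
    multiplier_norm (c *: S) <= `|c| * multiplier_norm S.
  rewrite -[`|c|]Re_cnormK -rmorphM/= lecR; apply: multiplier_rnorm_le => a a1.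
  have c0 : 0 <= complex.Re `|c|.
    by rewrite -(raddf0 (@complex.Re R)); exact/le_Re/normr_ge0.
  apply: (le_trans _ (ler_wpM2l c0 (multiplier_rnorm_ub S a1))).
  by rewrite multlZ normrZ -[`|c|]Re_cnormK -[`|multl S a|]Re_normK -rmorphM.
apply/eqP; rewrite eq_le leZ/=; have [->|k0] := eqVneq k 0.
  by rewrite normr0 mul0r multiplier_norm_ge0.
have := leZ k^-1 (k *: T); rewrite scalerA mulVf// scale1r => h.
by rewrite -ler_pdivlMl ?normr_gt0// -normfV.
Qed.

Lemma cstar_faithful rho sigma (x : arrow C rho sigma) :
  (forall a : arrow C rho rho, acomp x a = 0) -> x = 0.
Proof.
move=> /(_ (acomp (astar x) x)) h; set y := acomp (astar x) x in h.
have sy : astar y = y by rewrite /y astar_comp ?astarK//; exact: cstarP.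
have y0 : `|y| ^+ 2 = 0.
  rewrite -(cstar_identity (cstarP C)) sy {1}/y -(acompA (cstarP C)) h.
  by rewrite acomp0r normr0.
have /eqP := y0; rewrite expf_eq0 /= /y (cstar_identity (cstarP C)).
by rewrite expf_eq0 /= normr_eq0 => /eqP.
Qed.

Lemma eq_multiplier rho sigma (T S : multiplier rho sigma) :
  multl T =1 multl S -> multr T =1 multr S -> T = S.
Proof.
move=> hl hr; apply: val_inj => /=.
rewrite [LHS]surjective_pairing [RHS]surjective_pairing.
by congr pair; apply/funext.
Qed.

Lemma multiplier_norm0_eq0 rho sigma (T : multiplier rho sigma) :
  multiplier_norm T = 0 -> T = 0.
Proof.
move=> /(congr1 (@complex.Re R)) /= T0.
have l0 a : multl T a = 0.
  have [->|a0] := eqVneq a 0.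
    apply: (addrI (multl T 0)).
    by have := multl_linear (multiplierP T) 1 0 0; rewrite !scale1r !addr0.
  have a1 : `| `|a|^-1 *: a| <= 1 by rewrite normfZV.
  have := multiplier_rnorm_ub T a1; rewrite T0.
  rewrite -lecR Re_normK normr_le0 => /eqP h.
  have := multl_linear (multiplierP T) `|a| (`|a|^-1 *: a) 0.
  rewrite scalerA mulfV ?normr_eq0// scale1r addr0 h scaler0 add0r => ->.
  apply: (addrI (multl T 0)).
  by have := multl_linear (multiplierP T) 1 0 0; rewrite !scale1r !addr0.
apply: eq_multiplier => [a|b]; first by rewrite l0.
apply: cstar_faithful => a.
by rewrite -(mult_middle (multiplierP T)) l0 acomp0r.
Qed.

HB.instance Definition _ rho sigma :=
  Lmodule_isNormed.Build R[i] (multiplier rho sigma)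
    (@multiplier_normD rho sigma) (@multiplier_normZ rho sigma)
    (@multiplier_norm0_eq0 rho sigma).

Lemma multiplier_one_subproof rho :
  is_multiplier (idfun : arrow C rho rho -> _) idfun.
Proof. by split => //; exists 1 => v; rewrite mul1r. Qed.

Definition multiplier_one rho : multiplier rho rho :=
  mk_multiplier (multiplier_one_subproof rho).

Lemma multiplier_of_subproof rho sigma (t : arrow C rho sigma) :
  is_multiplier (fun a : arrow C rho rho => acomp t a)
                (fun b : arrow C sigma sigma => acomp b t).
Proof.
split.
- exact: (acomp_linear_right (cstarP C)).
- by exists `|t| => a; exact: (acomp_norm (cstarP C)).
- by move=> a a'; rewrite (acompA (cstarP C)).
- exact: (acomp_linear_left (cstarP C)).
- by exists `|t| => b; rewrite mulrC; exact: (acomp_norm (cstarP C)).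
- by move=> b' b; rewrite (acompA (cstarP C)).
- by move=> a b; rewrite (acompA (cstarP C)).
Qed.

(* M_t *)
Definition multiplier_of rho sigma (t : arrow C rho sigma) :
    multiplier rho sigma :=
  mk_multiplier (multiplier_of_subproof t).

Lemma multiplier_star_subproof rho sigma (T : multiplier rho sigma) :
  is_multiplier (fun b : arrow C sigma sigma => astar (multr T (astar b)))
                (fun a : arrow C rho rho => astar (multl T (astar a))).
Proof.
have [l1 l2 l3 r1 r2 r3 m] := multiplierP T; have cC := cstarP C.
have lin (a b c d : Ob) (f : arrow C a b -> arrow C c d) :
    linear f -> linear (fun v => astar (f (astar v))).
  move=> fl k u v; rewrite (astar_antilinear cC) fl (astar_antilinear cC).
  by rewrite conjcK.
have bdd (a b c d : Ob) (f : arrow C a b -> arrow C c d) :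
    bounded_map f -> bounded_map (fun v => astar (f (astar v))).
  move=> [k fk]; exists k => v; rewrite (astar_norm cC).
  by rewrite -[`|v|](astar_norm cC) fk.
split; [exact: lin|exact: bdd| |exact: lin|exact: bdd| |].
- by move=> a a'; rewrite (astar_comp cC) r3 (astar_comp cC) (astarK cC).
- by move=> a a'; rewrite (astar_comp cC) l3 (astar_comp cC) (astarK cC).
- move=> b a; rewrite -[X in acomp X _](astarK cC) -(astar_comp cC) -m.
  by rewrite (astar_comp cC) (astarK cC).
Qed.

(* T^* *)
Definition multiplier_star rho sigma (T : multiplier rho sigma) :
    multiplier sigma rho :=
  mk_multiplier (multiplier_star_subproof T).

(* The filter [F] is the filter of tails of the net (e_lambda). *)
Record is_approximate_unit sigma (F : set_system (arrow C sigma sigma)) : Prop :=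
  IsApproximateUnit {
  approximate_unit_proper : ProperFilter F;
  approximate_unit_positive :
    \forall e \near F, positive_arrow e /\ `|e| <= 1;
  approximate_unit_left : forall a : arrow C sigma sigma,
    acomp e a @[e --> F] --> a;
  approximate_unit_right : forall a : arrow C sigma sigma,
    acomp a e @[e --> F] --> a
}.

(* Some approximate unit of the C*-algebra (sigma, sigma); the default value is
   never used, as every C*-algebra has an approximate unit. *)
Definition approximate_unit sigma : set_system (arrow C sigma sigma) :=
  xget (nbhs (0 : arrow C sigma sigma)) (@is_approximate_unit sigma).

(* St := lim (S e) o t *)
Definition multiplier_actl rho sigma tau
    (S : multiplier sigma tau) (t : arrow C rho sigma) : arrow C rho tau :=
  lim (acomp (multl S e) t @[e --> @approximate_unit sigma]).

(* t'T := lim t' o (e T) *)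
Definition multiplier_actr rho sigma tau
    (t' : arrow C sigma tau) (T : multiplier rho sigma) : arrow C rho tau :=
  lim (acomp t' (multr T e) @[e --> @approximate_unit sigma]).

Definition is_multiplier_comp rho sigma tau (S : multiplier sigma tau)
    (T : multiplier rho sigma) (U : multiplier rho tau) : Prop :=
  (forall a : arrow C rho rho, multl U a = multiplier_actl S (multl T a)) /\
  (forall c : arrow C tau tau, multr U c = multiplier_actr (multr S c) T).

(* The multiplier S o T, i.e. the unique U with [is_multiplier_comp S T U]. *)
Definition multiplier_comp rho sigma tau (S : multiplier sigma tau)
    (T : multiplier rho sigma) : multiplier rho tau :=
  xget 0 (is_multiplier_comp S T).

(* M(C) *)
Definition multiplier_category : cstarData R Ob :=
  CstarData multiplier_comp multiplier_star.

End MultiplierSpace.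

Arguments multiplier_of {R Ob} C rho sigma t.

(* Main.v *)
(* Positivity in a unital C*-algebra is handled without spectral theory: a
   self-adjoint h is called positive if ||c - h|| <= c for some real c, which
   makes sums of positive elements positive, and positive square roots come from
   the fixed point iteration y |-> (x + y^2) / 2 for 1 - sqrt (1 - x). Kaplansky's
   theorem that every b^* b is positive follows, and with it approximate units of
   the form (1 - (1 - h)^n)^2 in the algebras (rho, rho), which are ideals of the
   unital algebras M(rho, rho).

   The action S t := lim (S e) t is characterised by c (S t) = (c S) t for all
   endomorphisms c, and all algebraic laws of M(C) follow from this identity. The
   C*-identity comes from ||T a||^2 = ||a^* (T^* T a)||. If T^* T were not positive,
   compressing it to its negative part would contradict the positivity of the
   arrows (T z a)^* (T z a) of C. *)

Require Import Defs.
From HB Require Import structures.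
From mathcomp Require Import all_boot all_order all_algebra.
From mathcomp Require Import mathcomp_extra boolp classical_sets functions.
From mathcomp Require Import reals topology normedtype.
From mathcomp Require Import complex ring lra.

Set Implicit Arguments.
Unset Strict Implicit.
Unset Printing Implicit Defensive.

Import Order.TTheory GRing.Theory Num.Theory.
Import numFieldNormedType.Exports.

Local Open Scope classical_set_scope.
Local Open Scope ring_scope.

(** * Real-valued norms *)

(** The limits defining [multiplier_comp] need approximate units. These are built inside a unital
    algebra containing (sigma, sigma), and the natural candidate M(sigma, sigma) already involves
    composition of multipliers. The circle is broken because on one object S (T a) is plain
    composition of maps and needs no limit. Hence the algebra of multipliers is developed once, over
    an abstract [is_mult_action] indexed by a map [f : Ix -> Ob], and instantiated twice: with
    [multl] on the single object rho and then, approximate units being available, with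
    [multiplier_actl] on all objects. Kaplansky's argument adds c^* c and c c^*, so it makes sense
    for endomorphisms only. For T in M(rho, sigma) with rho and sigma distinct, positivity of T^* T
    has to be drawn from the positivity axiom of C, which is the reason for the compression to the
    negative part. *)

Section RealNorm.
Context {R : realType} {V : normedModType R[i]}.
Implicit Types (x y : V) (r : R).

Definition nrm x : R := complex.Re `|x|.

Lemma nrmE x : `|x| = (nrm x)%:C%C.
Proof. by rewrite Re_normK. Qed.

Lemma nrm_ge0 x : 0 <= nrm x.
Proof. by rewrite -ler0c -nrmE. Qed.

Lemma nrm_le x r : (nrm x <= r) = (`|x| <= r%:C%C).
Proof. by rewrite nrmE lecR. Qed.

Lemma nrm0 : nrm 0 = 0.
Proof. by rewrite /nrm normr0. Qed.

Lemma nrm0_eq0 x : nrm x = 0 -> x = 0.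
Proof. by move=> h; apply/normr0_eq0; rewrite nrmE h. Qed.

Lemma nrm_le0 x : nrm x <= 0 -> x = 0.
Proof. by move=> h; apply: nrm0_eq0; apply/eqP; rewrite eq_le h nrm_ge0. Qed.

Lemma nrmN x : nrm (- x) = nrm x.
Proof. by rewrite /nrm normrN. Qed.

Lemma nrmB x y : nrm (x - y) = nrm (y - x).
Proof. by rewrite /nrm distrC. Qed.

Lemma nrmD x y : nrm (x + y) <= nrm x + nrm y.
Proof. by rewrite nrm_le rmorphD /= -!nrmE ler_normD. Qed.

Lemma nrmZ (k : R[i]) x : nrm (k *: x) = complex.Re `|k| * nrm x.
Proof.
by apply: (@complexI R); rewrite -nrmE normrZ rmorphM /= Re_cnormK -nrmE.
Qed.

Lemma nrmZr r x : nrm (r%:C%C *: x) = `|r| * nrm x.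
Proof. by rewrite nrmZ normc_def /= expr0n /= addr0 sqrtr_sqr. Qed.

(** The domination forces [eta] to be nondecreasing, and a bounded nondecreasing sequence moves
    little beyond an index where it is close to its supremum. No rate is asked for, since [sqmajor]
    below approaches 1 only sublinearly. *)
Lemma nrm_cauchy_cvg :
  (forall F : set_system V, ProperFilter F -> cauchy F -> cvg F) ->
  forall (u : nat -> V) (eta : nat -> R),
    (forall n m, (n <= m)%N -> nrm (u m - u n) <= eta m - eta n) ->
    (forall n, eta n <= 1) ->
  exists l, forall e : R, 0 < e ->
    exists N, forall n, (N <= n)%N -> nrm (u n - l) < e.
Proof.
move=> compl u eta hu h1.
have hs : has_sup (range eta).
  by split; [exists (eta 0%N), 0%N | exists 1 => _ [n _ <-]].
have tail e : 0 < e -> exists N, forall n m, (N <= n)%N -> (n <= m)%N ->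
    nrm (u m - u n) < e.
  move=> e0; have [_ [N _ <-] hN] := sup_adherent e0 hs.
  exists N => n m Nn nm; apply: (le_lt_trans (hu _ _ nm)).
  have hm : eta m <= sup (range eta).
    by apply: sup_upper_bound => //; exists m.
  have hn : eta N <= eta n.
    by rewrite -subr_ge0; apply: (le_trans (nrm_ge0 _) (hu _ _ Nn)).
  by lra.
have h : cvg (u @ \oo).
  apply: compl; apply/cauchy_exP => e e0.
  have er : e = (complex.Re e)%:C%C by rewrite RRe_real// gtr0_real.
  move: e0; rewrite er ltcR => e0.
  have [N hN] := tail _ e0; exists (u N), N => // n Nn.
  by rewrite -ball_normE /ball_ /= distrC nrmE ltcR hN.
exists (lim (u @ \oo)) => e e0.
have /cvgrPdist_lt/(_ e%:C%C) := h; rewrite ltcR => /(_ e0)[N _ hN].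
exists N => n Nn; rewrite nrmB.
by have := hN n Nn; rewrite nrmE ltcR.
Qed.

End RealNorm.

(** * Positivity in unital C*-algebras *)

Section AddedStar.
Context {R : realType} {Ob : Type} (C : cstarCategory R Ob).

Lemma astarD {rho sigma} (t u : arrow C rho sigma) :
  astar (t + u) = astar t + astar u.
Proof.
by have := astar_antilinear (cstarP C) 1 t u; rewrite conjc1 !scale1r.
Qed.

Lemma astar0 {rho sigma} : astar (0 : arrow C rho sigma) = 0.
Proof. by apply: (addrI (astar 0)); rewrite -astarD !addr0. Qed.

Lemma astarN {rho sigma} (t : arrow C rho sigma) : astar (- t) = - astar t.
Proof. by apply: (addrI (astar t)); rewrite -astarD !subrr astar0. Qed.

Lemma astarB {rho sigma} (t u : arrow C rho sigma) :
  astar (t - u) = astar t - astar u.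
Proof. by rewrite astarD astarN. Qed.

Lemma astarZ {rho sigma} k (t : arrow C rho sigma) :
  astar (k *: t) = conjc k *: astar t.
Proof.
by have := astar_antilinear (cstarP C) k t 0; rewrite astar0 !addr0.
Qed.

Lemma acompNr {rho sigma tau} (s : arrow C sigma tau) (t : arrow C rho sigma) :
  acomp s (- t) = - acomp s t.
Proof. by apply: (addrI (acomp s t)); rewrite -acompDr !subrr acomp0r. Qed.

Lemma acompNl {rho sigma tau} (s : arrow C sigma tau) (t : arrow C rho sigma) :
  acomp (- s) t = - acomp s t.
Proof. by apply: (addrI (acomp s t)); rewrite -acompDl !subrr acomp0l. Qed.

Lemma acompBr {rho sigma tau} (s : arrow C sigma tau) (t u : arrow C rho sigma) :
  acomp s (t - u) = acomp s t - acomp s u.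
Proof. by rewrite acompDr acompNr. Qed.

Lemma acompBl {rho sigma tau} (s s' : arrow C sigma tau) (t : arrow C rho sigma) :
  acomp (s - s') t = acomp s t - acomp s' t.
Proof. by rewrite acompDl acompNl. Qed.

Lemma nrm_comp {rho sigma tau} (s : arrow C sigma tau) (t : arrow C rho sigma) :
  nrm (acomp s t) <= nrm s * nrm t.
Proof. by rewrite nrm_le rmorphM /= -!nrmE (acomp_norm (cstarP C)). Qed.

Lemma nrm_astar {rho sigma} (t : arrow C rho sigma) : nrm (astar t) = nrm t.
Proof. by rewrite /nrm (astar_norm (cstarP C)). Qed.

Lemma nrm_cstar {rho sigma} (t : arrow C rho sigma) :
  nrm (acomp (astar t) t) = nrm t ^+ 2.
Proof.
by apply: (@complexI R); rewrite rmorphXn /= -!nrmE (cstar_identity (cstarP C)).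
Qed.

End AddedStar.

(** The identity proof is a parameter of the type so that the ring instance can read off its unit.
    Nothing forces [1 != 0], as the arrow space may be zero. *)
Definition endo {R : realType} {Ob : Type} {C : cstarCategory R Ob} {rho : Ob}
  {e : arrow C rho rho} (he : is_identity e) : Type := arrow C rho rho.

Section EndoRing.
Context {R : realType} {Ob : Type} {C : cstarCategory R Ob} {rho : Ob}.
Context {one : arrow C rho rho} (h1 : is_identity one).

HB.instance Definition _ := NormedModule.copy (endo h1) (arrow C rho rho).

Local Notation B := (endo h1).

Let emul (x y : B) : B := acomp x y.

Let emulA : associative emul.
Proof. by move=> x y z; exact: (acompA (cstarP C)). Qed.
Let emul1r : left_id (one : B) emul.
Proof. exact: h1.2. Qed.
Let emulr1 : right_id (one : B) emul.
Proof. exact: h1.1. Qed.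
Let emulDl : left_distributive emul +%R.
Proof. by move=> x y z; exact: acompDl. Qed.
Let emulDr : right_distributive emul +%R.
Proof. by move=> x y z; exact: acompDr. Qed.

HB.instance Definition _ :=
  GRing.Zmodule_isPzRing.Build (endo h1) emulA emul1r emulr1 emulDl emulDr.

End EndoRing.

Section UnitalTheory.
Context {R : realType} {Ob : Type} {C : cstarCategory R Ob} {rho : Ob}.
Context {one : arrow C rho rho} {h1 : is_identity one}.
Local Notation B := (endo h1).
Implicit Types (x y z h k s t : B) (r c e : R).

Definition adj x : B := astar x.

Lemma adjD x y : adj (x + y) = adj x + adj y. Proof. exact: astarD. Qed.
Lemma adjB x y : adj (x - y) = adj x - adj y. Proof. exact: astarB. Qed.
Lemma adj0 : adj 0 = 0. Proof. exact: astar0. Qed.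
Lemma adjM x y : adj (x * y) = adj y * adj x.
Proof. exact: (astar_comp (cstarP C)). Qed.
Lemma adjK x : adj (adj x) = x. Proof. exact: (astarK (cstarP C)). Qed.
Lemma adj1 : adj 1 = 1.
Proof. by rewrite -[adj 1]mul1r -{1}[1]adjK -adjM mul1r adjK. Qed.
Lemma adjZ (k : R[i]) x : adj (k *: x) = conjc k *: adj x.
Proof. exact: astarZ. Qed.

Lemma nrmM x y : nrm (x * y) <= nrm x * nrm y.
Proof. exact: nrm_comp. Qed.
Lemma nrm_adj x : nrm (adj x) = nrm x.
Proof. exact: nrm_astar. Qed.
Lemma nrm_adjM x : nrm (adj x * x) = nrm x ^+ 2.
Proof. exact: nrm_cstar. Qed.
Lemma nrm_sq x : adj x = x -> nrm (x * x) = nrm x ^+ 2.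
Proof. by move=> hx; rewrite -{1}hx nrm_adjM. Qed.
Lemma nrm1_le1 : nrm (1 : B) <= 1.
Proof.
have := nrm_sq adj1; rewrite mulr1 => h; have h0 := nrm_ge0 (1 : B).
by nra.
Qed.

Lemma scaleMl (k : R[i]) x y : (k *: x) * y = k *: (x * y).
Proof. exact: acompZl. Qed.
Lemma scaleMr (k : R[i]) x y : x * (k *: y) = k *: (x * y).
Proof. exact: acompZr. Qed.

Definition sc r : B := r%:C%C *: (1 : B).

Lemma scD r c : sc (r + c) = sc r + sc c.
Proof. by rewrite /sc rmorphD scalerDl. Qed.
Lemma sc0 : sc 0 = 0.
Proof. by rewrite /sc scale0r. Qed.
Lemma sc1 : sc 1 = 1.
Proof. by rewrite /sc scale1r. Qed.
Lemma scN r : sc (- r) = - sc r.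
Proof. by rewrite /sc rmorphN scaleNr. Qed.
Lemma scB r c : sc (r - c) = sc r - sc c.
Proof. by rewrite scD scN. Qed.
Lemma scMl r x : sc r * x = r%:C%C *: x.
Proof. by rewrite /sc scaleMl mul1r. Qed.
Lemma scMr r x : x * sc r = r%:C%C *: x.
Proof. by rewrite /sc scaleMr mulr1. Qed.
Lemma scC r x : sc r * x = x * sc r.
Proof. by rewrite scMl scMr. Qed.
Lemma scM r c : sc (r * c) = sc r * sc c.
Proof. by rewrite scMl /sc scalerA rmorphM. Qed.
Lemma adj_sc r : adj (sc r) = sc r.
Proof. by rewrite /sc adjZ conjc_real adj1. Qed.
Lemma nrm_scM r x : nrm (sc r * x) = `|r| * nrm x.
Proof. by rewrite scMl nrmZr. Qed.
Lemma nrm_sc r : nrm (sc r) <= `|r|.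
Proof. by rewrite -[sc r]mulr1 nrm_scM ler_piMr // nrm1_le1. Qed.

Lemma nrm_eq0_lim x : (forall e, 0 < e -> nrm x <= e) -> x = 0.
Proof.
by move=> h; apply: nrm_le0; apply/ler_addgt0Pr => e e0; rewrite add0r h.
Qed.

End UnitalTheory.
Arguments sc {R Ob C rho one h1} r.

(** * Square roots by fixed point iteration *)

Section SquareRoot.
Context {R : realType} {Ob : Type} {C : cstarCategory R Ob} {rho : Ob}.
Context {one : arrow C rho rho} {h1 : is_identity one}.
Local Notation B := (endo h1).
Implicit Types (x y z h k s t : B) (r c e : R).

Lemma sqrB x y : x * x - y * y = (x - y) * x + y * (x - y).
Proof. by rewrite mulrBl mulrBr addrA subrK. Qed.

(* A fixed point [y] of [y |-> (x + y^2) / 2] satisfies [(1 - y)^2 = 1 - x]. *)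
Fixpoint sqiter x n : B :=
  if n is m.+1 then (2^-1)%:C%C *: (x + sqiter x m * sqiter x m) else 0.

(* The same iteration for the scalar 1, which dominates [sqiter x]. *)
Fixpoint sqmajor (n : nat) : R :=
  if n is m.+1 then 2^-1 * (1 + sqmajor m ^+ 2) else 0.

Lemma sqmajor_itv n : 0 <= sqmajor n <= 1.
Proof.
elim: n => [|n /andP[p q]] /=; first by rewrite lexx ler01.
by apply/andP; split; nra.
Qed.

Lemma nrm_sqiter x n : nrm x <= 1 -> nrm (sqiter x n) <= sqmajor n.
Proof.
move=> hx; elim: n => [|n IH] /=; first by rewrite nrm0.
rewrite nrmZr ger0_norm ?invr_ge0// ler_pM2l ?invr_gt0//.
apply: (le_trans (nrmD _ _)); apply: lerD => //.
by apply: (le_trans (nrmM _ _)); rewrite expr2 ler_pM ?nrm_ge0.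
Qed.

(** The identity [sqrB] holds without commutativity. For the scalar majorant it yields the same
    expression with every norm replaced by its bound, so the induction carries over. *)
Lemma sqiter_step x n : nrm x <= 1 ->
  nrm (sqiter x n.+1 - sqiter x n) <= sqmajor n.+1 - sqmajor n.
Proof.
move=> hx; elim: n => [|n].
  by rewrite !subr0 (le_trans (nrm_sqiter 1 hx)).
set y := sqiter x n.+1; set w := sqiter x n.
set p := sqmajor n.+1; set q := sqmajor n => IH.
have -> : sqiter x n.+2 - y = (2^-1)%:C%C *: ((y - w) * y + w * (y - w)).
  by rewrite -sqrB {2}/y /= -scalerBr opprD addrACA subrr add0r.
have -> : sqmajor n.+2 - p = 2^-1 * ((p - q) * p + q * (p - q)).
  have e1 : sqmajor n.+2 = 2^-1 * (1 + p ^+ 2) by [].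
  have e2 : p = 2^-1 * (1 + q ^+ 2) by [].
  by rewrite e1 [X in _ - X]e2; ring.
rewrite nrmZr ger0_norm ?invr_ge0// ler_pM2l ?invr_gt0//.
apply: (le_trans (nrmD _ _)).
by apply: lerD; apply: (le_trans (nrmM _ _)); rewrite ler_pM ?nrm_ge0//;
  exact: nrm_sqiter.
Qed.

Lemma sqiter_cauchy x n m : nrm x <= 1 -> (n <= m)%N ->
  nrm (sqiter x m - sqiter x n) <= sqmajor m - sqmajor n.
Proof.
move=> hx; elim: m => [|m IH].
  by rewrite leqn0 => /eqP ->; rewrite !subrr nrm0.
rewrite leq_eqVlt => /orP[/eqP ->|]; first by rewrite !subrr nrm0.
rewrite ltnS => /IH {}IH.
rewrite -(subrK (sqiter x m) (sqiter x m.+1)) -addrA.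
apply: (le_trans (nrmD _ _)).
have := sqiter_step m hx; lra.
Qed.

(** Taking [x = x'] gives commutation; the case of two different elements is the one used for
    Kaplansky's theorem. *)
Lemma sqiter_intertwine x x' z n :
  x * z = z * x' -> sqiter x n * z = z * sqiter x' n.
Proof.
move=> hz; elim: n => [|n IH] /=; first by rewrite mul0r mulr0.
rewrite scaleMl scaleMr; congr (_ *: _).
by rewrite mulrDl mulrDr hz -mulrA IH mulrA IH mulrA.
Qed.

Lemma adj_sqiter x n : adj x = x -> adj (sqiter x n) = sqiter x n.
Proof.
move=> hx; elim: n => [|n IH] /=; first by rewrite adj0.
by rewrite adjZ conjc_real adjD adjM hx IH.
Qed.

(** The norm bound stands under the existential so that [sqlim] is a total function; outside the
    unit ball its value carries no information. *)
Lemma sqlim_ex x : exists l, nrm x <= 1 -> forall e, 0 < e ->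
  exists N, forall n, (N <= n)%N -> nrm (sqiter x n - l) < e.
Proof.
have [hx|hx] := pselect (nrm x <= 1); last by exists 0 => /hx.
have [l hl] : exists l, forall e, 0 < e ->
    exists N, forall n, (N <= n)%N -> nrm (sqiter x n - l) < e.
  have compl := @arrow_complete _ _ _ (cstarP C) rho rho.
  apply: (@nrm_cauchy_cvg _ B compl _ sqmajor).
    by move=> n m; exact: sqiter_cauchy.
  by move=> n; have /andP[] := sqmajor_itv n.
by exists l.
Qed.

Definition sqlim x : B := projT1 (cid (sqlim_ex x)).

Lemma sqlimP x : nrm x <= 1 -> forall e, 0 < e ->
  exists N, forall n, (N <= n)%N -> nrm (sqiter x n - sqlim x) < e.
Proof. by rewrite /sqlim; case: cid. Qed.

Lemma sqlim_approx x x' e : nrm x <= 1 -> nrm x' <= 1 -> 0 < e ->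
  exists n, [/\ nrm (sqiter x n - sqlim x) < e,
     nrm (sqiter x n.+1 - sqlim x) < e & nrm (sqiter x' n - sqlim x') < e].
Proof.
move=> hx hx' e0; have [N hN] := sqlimP hx e0; have [M hM] := sqlimP hx' e0.
exists (maxn N M); split; [apply: hN|apply: hN|apply: hM].
- exact: leq_maxl.
- exact: leq_trans (leq_maxl _ _) (leqnSn _).
- exact: leq_maxr.
Qed.

Lemma nrm_sqlim x : nrm x <= 1 -> nrm (sqlim x) <= 1.
Proof.
move=> hx; apply/ler_addgt0Pr => e e0.
have [n [h _ _]] := sqlim_approx hx hx e0.
have -> : sqlim x = sqiter x n - (sqiter x n - sqlim x) by rewrite subKr.
apply: (le_trans (nrmD _ _)); rewrite nrmN lerD ?(ltW h)//.
by apply: (le_trans (nrm_sqiter n hx)); have /andP[] := sqmajor_itv n.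
Qed.

Lemma adj_sqlim x : nrm x <= 1 -> adj x = x -> adj (sqlim x) = sqlim x.
Proof.
move=> hx sx; apply/eqP; rewrite -subr_eq0; apply/eqP.
apply: nrm_eq0_lim => e e0.
have [n [h _ _]] := sqlim_approx hx hx (divr_gt0 e0 (ltr0n _ 2)).
have -> : adj (sqlim x) - sqlim x =
    - adj (sqiter x n - sqlim x) + (sqiter x n - sqlim x).
  by rewrite adjB adj_sqiter// opprB addrA subrK.
apply: (le_trans (nrmD _ _)); rewrite nrmN nrm_adj; lra.
Qed.

Lemma sqlim_intertwine x x' z : nrm x <= 1 -> nrm x' <= 1 ->
  x * z = z * x' -> sqlim x * z = z * sqlim x'.
Proof.
move=> hx hx' hz; apply/eqP; rewrite -subr_eq0; apply/eqP.
apply: nrm_eq0_lim => e e0.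
have d0 : 0 < 2 * nrm z + 1 by have := nrm_ge0 z; lra.
have [n [h _ h']] := sqlim_approx hx hx' (divr_gt0 e0 d0).
have -> : sqlim x * z - z * sqlim x' =
    - ((sqiter x n - sqlim x) * z) + z * (sqiter x' n - sqlim x').
  rewrite mulrBl mulrBr (sqiter_intertwine n hz) opprB.
  by rewrite addrA subrK.
apply: (le_trans (nrmD _ _)); rewrite nrmN.
apply: (le_trans (lerD (nrmM _ _) (nrmM _ _))).
have z0 := nrm_ge0 z.
apply: (@le_trans _ _ (e / (2 * nrm z + 1) * (2 * nrm z + 1))); last first.
  by rewrite divfK// gt_eqF.
have := nrm_ge0 (sqiter x n - sqlim x).
move: (e / _) (nrm (_ - _)) (nrm (_ - _)) h h' => d a b h h' a0; nra.
Qed.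

Lemma sqlim_fix x : nrm x <= 1 ->
  sqlim x = (2^-1)%:C%C *: (x + sqlim x * sqlim x).
Proof.
move=> hx; apply/eqP; rewrite -subr_eq0; apply/eqP.
apply: nrm_eq0_lim => e e0.
have [n [h h' _]] := sqlim_approx hx hx (divr_gt0 e0 (ltr0n _ 2)).
have hn := le_trans (nrm_sqiter n hx) (proj2 (andP (sqmajor_itv n))).
have hl := nrm_sqlim hx.
move: h h'; rewrite /=; move: (sqiter x n) (sqlim x) hn hl => y l hn hl h h'.
have -> : l - (2^-1)%:C%C *: (x + l * l) =
  - ((2^-1)%:C%C *: (x + y * y) - l)
  + (2^-1)%:C%C *: ((y - l) * y + l * (y - l)).
  by rewrite -sqrB scalerBr !scalerDr opprB !opprD !addrA subrK.
apply: (le_trans (nrmD _ _)); rewrite nrmN nrmZr ger0_norm ?invr_ge0//.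
have h3 : nrm ((y - l) * y + l * (y - l)) <= e.
  apply: (le_trans (nrmD _ _)); apply: (le_trans (lerD (nrmM _ _) (nrmM _ _))).
  have := nrm_ge0 (y - l); have := nrm_ge0 y; have := nrm_ge0 l; nra.
by lra.
Qed.

Lemma sqlim_sqr x : nrm x <= 1 -> (1 - sqlim x) * (1 - sqlim x) = 1 - x.
Proof.
move=> hx; have h := sqlim_fix hx; move: (sqlim x) h => l h.
have h2 : l + l = x + l * l.
  rewrite {1 2}h -scalerDl -rmorphD /=.
  by rewrite [2^-1 + _](_ : _ = 1) ?scale1r//; lra.
have -> : x = l + l - l * l by rewrite h2 addrK.
rewrite mulrBl mul1r mulrBr mulr1 !opprB -addrA; congr (1 + _).
by rewrite addrCA opprD.
Qed.

End SquareRoot.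

(** * Positive elements: roots, norm estimates and Kaplansky's theorem *)

Section Positivity.
Context {R : realType} {Ob : Type} {C : cstarCategory R Ob} {rho : Ob}.
Context {one : arrow C rho rho} {h1 : is_identity one}.
Local Notation B := (endo h1).
Implicit Types (x y z h k s t : B) (r c e : R).

Lemma half_add1 : (2^-1)%:C%C * (1 + 1) = 1 :> R[i].
Proof.
rewrite -(rmorph1 (real_complex R)) -rmorphD -rmorphM /=.
by congr (_%:C)%C; lra.
Qed.

(* For self-adjoint [h] this norm condition says that the spectrum of [h] is
   nonnegative; it makes sums of positive elements trivially positive. *)
Definition psd h := adj h = h /\ exists c, nrm (sc c - h) <= c.

(** The witness in [psd] may grow: it can be made positive, or shared by two elements. *)
Lemma sc_ball_le h c e : c <= e -> nrm (sc c - h) <= c -> nrm (sc e - h) <= e.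
Proof.
move=> ce hc; have -> : sc e - h = sc (e - c) + (sc c - h).
  by rewrite scB addrA subrK.
apply: (le_trans (nrmD _ _)); have := @nrm_sc _ _ _ _ _ h1 (e - c).
by rewrite ger0_norm ?subr_ge0//; lra.
Qed.

Lemma psd_ball h : psd h -> exists2 c, 0 < c & nrm (sc c - h) <= c.
Proof.
move=> [_ [c hc]]; have c0 := le_trans (nrm_ge0 _) hc.
by exists (c + 1); [lra | apply: sc_ball_le hc; lra].
Qed.

Lemma psd_adj h : psd h -> adj h = h. Proof. by case. Qed.

Lemma psd_sc_sub h c : adj h = h -> nrm h <= c -> psd (sc c - h).
Proof.
move=> ah hc; split; first by rewrite adjB adj_sc ah.
by exists c; rewrite subKr.
Qed.

Lemma psdD x y : psd x -> psd y -> psd (x + y).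
Proof.
move=> [ax [c hc]] [ay [e he]]; split; first by rewrite adjD ax ay.
exists (c + e); rewrite scD opprD addrACA.
by apply: (le_trans (nrmD _ _)); rewrite lerD.
Qed.

Lemma psd_scale c x : 0 <= c -> psd x -> psd (sc c * x).
Proof.
move=> c0 [ax [e he]]; split; first by rewrite adjM adj_sc ax scC.
exists (c * e); rewrite scM -mulrBr nrm_scM ger0_norm//.
by rewrite ler_wpM2l.
Qed.

Lemma psd_sc c : 0 <= c -> psd (sc c : B).
Proof.
move=> c0; split; first exact: adj_sc.
by exists c; rewrite subrr nrm0.
Qed.

Lemma psd0 : psd (0 : B).
Proof. by rewrite -sc0; exact: psd_sc. Qed.

(** If [nrm (sc c - h) <= c], then [1 - h / c] lies in the unit ball and the second factor is a
    square root of [h / c]. The constant stays a parameter because intertwined roots must come from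
    the same [c]. *)
Definition rt c h : B := sc (Num.sqrt c) * (1 - sqlim (1 - sc c^-1 * h)).

Lemma rt_nrm_le1 c h : 0 < c -> nrm (sc c - h) <= c ->
  nrm (1 - sc c^-1 * h) <= 1.
Proof.
move=> c0 hc; have -> : 1 - sc c^-1 * h = sc c^-1 * (sc c - h).
  by rewrite mulrBr -scM mulVf ?gt_eqF// sc1.
by rewrite nrm_scM ger0_norm ?invr_ge0 ?(ltW c0)// ler_pdivrMl ?mulr1.
Qed.

Lemma psd_rt c h : 0 < c -> adj h = h -> nrm (sc c - h) <= c -> psd (rt c h).
Proof.
move=> c0 ah hc; apply: psd_scale; rewrite ?sqrtr_ge0// -sc1.
have hl := rt_nrm_le1 c0 hc.
apply: psd_sc_sub; last by rewrite sc1; exact: nrm_sqlim.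
rewrite sc1; apply: adj_sqlim => //.
by rewrite adjB adj1 adjM adj_sc ah scC.
Qed.

Lemma rt_sqr c h : 0 < c -> nrm (sc c - h) <= c -> rt c h * rt c h = h.
Proof.
move=> c0 hc; rewrite /rt -mulrA [X in _ * X]mulrA -[X in _ * (X * _)]scC.
rewrite -[X in _ * X]mulrA mulrA -scM -expr2 sqr_sqrtr ?ltW//.
rewrite sqlim_sqr ?rt_nrm_le1// subKr mulrA -scM divff ?gt_eqF//.
by rewrite sc1 mul1r.
Qed.

Lemma rt_intertwine c h h' z : 0 < c -> nrm (sc c - h) <= c ->
  nrm (sc c - h') <= c -> h * z = z * h' -> rt c h * z = z * rt c h'.
Proof.
move=> c0 hc hc' hz; rewrite /rt -mulrA mulrBl mul1r.
rewrite (@sqlim_intertwine _ _ _ _ _ _ _ (1 - sc c^-1 * h')) ?rt_nrm_le1//.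
  by rewrite -{1}[z]mulr1 -mulrBr [LHS]mulrA [sc _ * z]scC -mulrA.
rewrite mulrBl mul1r mulrBr mulr1; congr (_ - _).
by rewrite -mulrA hz [LHS]mulrA [sc _ * z]scC -mulrA.
Qed.

Lemma psd_sqrt_intertwine h h' z : psd h -> psd h' -> h * z = z * h' ->
  exists s s', [/\ psd s, psd s', s * s = h, s' * s' = h' & s * z = z * s'].
Proof.
move=> ph ph' hz; have [c c0 hc] := psd_ball ph.
have [e e0 he] := psd_ball ph'.
have hd : nrm (sc (Num.max c e) - h) <= Num.max c e.
  by apply: sc_ball_le hc; rewrite le_max lexx.
have hd' : nrm (sc (Num.max c e) - h') <= Num.max c e.
  by apply: sc_ball_le he; rewrite le_max lexx orbT.
have d0 : 0 < Num.max c e by rewrite lt_max c0.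
exists (rt (Num.max c e) h), (rt (Num.max c e) h'); split.
- by apply: psd_rt => //; exact: psd_adj.
- by apply: psd_rt => //; exact: psd_adj.
- exact: rt_sqr.
- exact: rt_sqr.
- exact: rt_intertwine.
Qed.

Lemma psd_sqrt h : psd h ->
  exists s, [/\ psd s, s * s = h & forall z, h * z = z * h -> s * z = z * s].
Proof.
move=> ph; have [c c0 hc] := psd_ball ph.
exists (rt c h); split.
- by apply: psd_rt => //; exact: psd_adj.
- exact: rt_sqr.
- by move=> z; exact: rt_intertwine.
Qed.

(* [u = s + i t] is normal and [u^* u = c]. *)
Lemma nrm_sqr_sum s t c : 0 <= c -> adj s = s -> adj t = t -> s * t = t * s ->
  s * s + t * t = sc c -> nrm s ^+ 2 <= c.
Proof.
move=> c0 as_ at_ st hc; pose i : R[i] := 'i%C; pose u := s + i *: t.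
have i2 : i * i = -1 by rewrite /i; simpc.
have au : adj u = s - i *: t.
  rewrite /u adjD adjZ as_ at_ -scaleNr; congr (_ + _ *: _).
  by rewrite /i; simpc.
have uu : adj u * u = sc c.
  rewrite -hc au /u mulrBl !mulrDr scaleMl scaleMr scaleMl scaleMr scalerA i2.
  by rewrite scaleN1r st opprD opprK addrA addrK.
have hu : nrm u ^+ 2 <= c.
  by rewrite -nrm_adjM uu -[leRHS]ger0_norm// nrm_sc.
have hs : s = (2^-1)%:C%C *: (u + adj u).
  by rewrite au /u addrACA subrr addr0 -{2 3}[s]scale1r -scalerDl scalerA
    half_add1 scale1r.
apply: (le_trans _ hu); rewrite lerXn2r ?nnegrE ?nrm_ge0// hs nrmZr.
rewrite ger0_norm ?invr_ge0// ler_pdivrMl//.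
by apply: (le_trans (nrmD _ _)); rewrite nrm_adj; lra.
Qed.

(** The element [sc c - s * s] is positive, since its distance to [sc c] is the norm of [s * s]. Its
    root [r] commutes with [s] and [r^2 + s^2 = c], so [nrm_sqr_sum] bounds [nrm r ^+ 2], hence the
    norm of [r * r]. *)
Lemma sqr_ball s c : adj s = s -> nrm s ^+ 2 <= c ->
  nrm (sc c - s * s) <= c.
Proof.
move=> as_ hc; have c0 : 0 <= c by apply: (le_trans _ hc); rewrite sqr_ge0.
have hp : psd (sc c - s * s).
  by apply: psd_sc_sub; rewrite ?nrm_sq// adjM as_.
have [r [[ar _] rr rC]] := psd_sqrt hp.
rewrite -rr; apply: (le_trans (nrmM _ _)); rewrite -expr2.
apply: (@nrm_sqr_sum _ s) => //; last by rewrite rr subrK.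
by apply: rC; rewrite mulrBl mulrBr scC mulrA.
Qed.

Lemma psd_sqr s : adj s = s -> psd (s * s).
Proof.
move=> as_; split; first by rewrite adjM as_.
by exists (nrm s ^+ 2); exact: sqr_ball.
Qed.

(** Once [h] is written as a square, the witness in [psd] can be lowered to any bound of the norm;
    this makes [1 - h] a contraction in the construction of approximate units. *)
Lemma psd_nrm_ball h c : psd h -> nrm h <= c -> nrm (sc c - h) <= c.
Proof.
move=> /psd_sqrt [s [[as_ _] <- _]] hc.
by apply: sqr_ball => //; rewrite -nrm_sq.
Qed.

Lemma psd_nrm_le x c : 0 <= c -> psd x -> psd (sc c - x) -> nrm x <= c.
Proof.
move=> c0 /psd_sqrt [s [[as_ _] <- _]] hp.
have [r [[ar _] rr rC]] := psd_sqrt hp.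
rewrite nrm_sq//; apply: (@nrm_sqr_sum _ r) => //; last by rewrite rr addrC subrK.
by apply/esym/rC; rewrite mulrBl mulrBr scC mulrA.
Qed.

Lemma psd_nrm_mono x y : psd x -> psd (y - x) -> nrm x <= nrm y.
Proof.
move=> px pyx; apply: psd_nrm_le => //; first exact: nrm_ge0.
rewrite -(subrK y (sc (nrm y))) -addrA; apply: psdD => //.
apply: psd_sc_sub => //.
by rewrite -(subrK x y) adjD (psd_adj px) (psd_adj pyx).
Qed.

Lemma psd_anti x : psd x -> psd (- x) -> x = 0.
Proof.
by move=> px pnx; apply: nrm_le0; rewrite psd_nrm_le// sc0 sub0r.
Qed.

Lemma psdD_eq0 x y : psd x -> psd y -> x + y = 0 -> x = 0.
Proof.
by move=> px py /eqP; rewrite addr_eq0 => /eqP xy; apply: psd_anti;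
  rewrite // xy opprK.
Qed.

Lemma psdM x y : x * y = y * x -> psd x -> psd y -> psd (x * y).
Proof.
move=> xy /psd_sqrt [s [[as_ _] hs sC]] /psd_sqrt [t [[at_ _] ht tC]].
have sy : s * y = y * s by exact: sC.
have st : t * s = s * t by apply: tC; rewrite sy.
rewrite -hs -ht mulrA -[s * s * t]mulrA -st mulrA -mulrA.
by apply: psd_sqr; rewrite adjM as_ at_.
Qed.

Lemma sa_sqr0 x : adj x = x -> x * x = 0 -> x = 0.
Proof.
move=> ax xx; apply: nrm0_eq0; apply/eqP.
by rewrite -sqrf_eq0 -nrm_sq// xx nrm0.
Qed.

Lemma sa_cube0 x : adj x = x -> x * x * x = 0 -> x = 0.
Proof.
move=> ax xxx; apply: sa_sqr0 => //; apply: sa_sqr0; first by rewrite adjM ax.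
by rewrite mulrA xxx mul0r.
Qed.

(** As [s] and [t] are not known to commute, each is compared with the root [w] from [psd_sqrt],
    which commutes with whatever commutes with the square. For such a commuting pair and
    [d = r - w], the positive elements [d^2 r] and [d^2 w] add up to [d (r^2 - w^2) = 0], so both
    vanish and [d^3 = 0]. *)
Lemma psd_sqrt_uniq s t : psd s -> psd t -> s * s = t * t -> s = t.
Proof.
suff main h (r : B) : psd r -> r * r = h -> psd h ->
    forall w, psd w -> w * w = h ->
    (forall z, h * z = z * h -> w * z = z * w) -> r = w.
  move=> ps pt st; have psq := psd_sqr (psd_adj ps).
  have [w [pw ww wC]] := psd_sqrt psq.
  by rewrite (main _ _ ps erefl psq _ pw ww wC) (main _ _ pt (esym st) psq _ pw ww wC).
move=> pr rr ph w pw ww wC.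
have wr : w * r = r * w by apply: wC; rewrite -rr mulrA.
pose d := r - w; have ad : adj d = d by rewrite adjB !psd_adj.
have dr : d * r = r * d by rewrite /d mulrBl mulrBr wr.
have dw : d * w = w * d by rewrite /d mulrBl mulrBr wr.
have psq := psd_sqr ad.
have p1 : psd (d * d * r).
  by apply: psdM => //; rewrite -mulrA dr mulrA dr mulrA.
have p2 : psd (d * d * w).
  by apply: psdM => //; rewrite -mulrA dw mulrA dw mulrA.
have s0 : d * d * r + d * d * w = 0.
  rewrite -mulrDr -mulrA [X in _ * X](_ : _ = 0) ?mulr0//.
  by rewrite /d mulrBl !mulrDr wr rr ww addrKA subrr.
have z1 := psdD_eq0 p1 p2 s0; have z2 : d * d * w = 0.
  by move: s0; rewrite z1 add0r.
apply/eqP; rewrite -subr_eq0; apply/eqP; apply: sa_cube0 => //.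
by rewrite -/d {3}/d mulrBr z1 z2 subr0.
Qed.

(* With [k = |h|], the element [z = k - h] is twice the negative part of [h]. *)
Lemma sa_negative_part h : adj h = h -> exists z q,
  [/\ adj z = z, adj q = q, z * h * z = - (q * q) & q * q = 0 -> psd h].
Proof.
move=> ah; have [k [pk kk kC]] := psd_sqrt (psd_sqr ah).
have kh : k * h = h * k by apply: kC; rewrite mulrA.
have [s [ps ss sC]] := psd_sqrt pk.
pose z := k - h; have az : adj z = z by rewrite adjB ah psd_adj.
have zk : k * z = z * k by rewrite /z mulrBl mulrBr kh.
have sz : s * z = z * s by exact: sC.
have qq : (s * z) * (s * z) = k * z * z.
  by rewrite {2}sz mulrA -[s * z * z]mulrA -[s * (z * z) * s]mulrA -[z * z * s]mulrA
    -sz [z * (s * z)]mulrA -sz !mulrA ss.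
(* Here [z h = k h - h^2 = k h - k^2 = - k z], and [q = s z] with [s^2 = k] gives [q^2 = k z^2]. If
   this vanishes, [z^2 = 2 k z] yields [z^3 = 0], so [h = k]. *)
exists z, (s * z); split=> //.
- by rewrite adjM az psd_adj.
- rewrite qq [z * h](_ : _ = - (k * z)) ?mulNr//.
  by rewrite /z mulrBl mulrBr kh kk opprB.
- rewrite qq => kzz; suff z0 : z = 0.
    by have /eqP := z0; rewrite subr_eq0 => /eqP <-.
  apply: sa_cube0 => //; have -> : z * z = k * z + k * z.
    rewrite {1}/z mulrBl; congr (_ + _).
    by rewrite /z !mulrBr kh kk opprB.
  by rewrite mulrDl kzz addr0.
Qed.

Lemma psd_half x : psd (x + x) -> psd x.
Proof.
move=> p; have -> : x = sc 2^-1 * (x + x).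
  by rewrite scMl -{2 3}[x]scale1r -scalerDl scalerA half_add1 scale1r.
by apply: psd_scale; rewrite ?invr_ge0.
Qed.

Lemma add_self_eq0 x : x + x = 0 -> x = 0.
Proof.
move=> xx; have h : psd (x + x) by rewrite xx; exact: psd0.
by apply: (psdD_eq0 (psd_half h) (psd_half h)).
Qed.

(** Up to sign, [a] and [b] are twice the real and imaginary parts of [x]; the cross terms cancel in
    [a^2 + b^2], leaving twice the sum. *)
Lemma psd_sqr_sum x : psd (adj x * x + x * adj x).
Proof.
pose i : R[i] := 'i%C; pose a := x + adj x; pose b := i *: (x - adj x).
have i2 : i * i = -1 by rewrite /i; simpc.
have aa : adj a = a by rewrite /a adjD adjK addrC.
have ab : adj b = b.
  rewrite /b adjZ adjB adjK -[x - _]opprB scalerN -scaleNr.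
  by congr (_ *: _); rewrite /i; simpc.
apply: psd_half; set w := _ + _ * adj x.
have -> : w + w = a * a + b * b; last by apply: psdD; exact: psd_sqr.
rewrite /b scaleMl scaleMr scalerA i2 scaleN1r /a /w.
rewrite !(mulrDl, mulrDr, mulNr, mulrN, opprK, opprD).
have E p q u v : q + p + (q + p) = u + p + (q + v) + (- u + p + (q - v)) :> B.
  rewrite [q + v]addrC [u + p + _]addrACA [q - v]addrC [- u + p + _]addrACA.
  by rewrite -opprD [RHS]addrACA subrr add0r [p + q]addrC.
exact: E.
Qed.

(** Let [p = q^2] and [c = b z], so that [c^* c = - p]. Then [r = c c^*] is positive, being
    [c^* c + c c^*] plus [p], and [r c = - c p] implies [r^2 c = c p^2]. Positive roots intertwine,
    so [r c = c p] too; hence [c p = 0], [p^2 = 0] and [p = 0]. This takes the place of the usual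
    comparison of the spectra of [c^* c] and [c c^*]. *)
Lemma psd_adjM b : psd (adj b * b).
Proof.
have [z [q [az aq zhz]]] : exists z q, [/\ adj z = z, adj q = q,
   z * (adj b * b) * z = - (q * q) & q * q = 0 -> psd (adj b * b)].
  by apply: sa_negative_part; rewrite adjM adjK.
apply; pose c := b * z; pose p := q * q; pose r := c * adj c.
have pp : psd p by exact: psd_sqr.
have cc : adj c * c = - p.
  by rewrite /c adjM az /p -zhz !mulrA.
have pr : psd r.
  have -> : r = (adj c * c + r) + p by rewrite cc addrC addrA subrr add0r.
  by apply: psdD => //; exact: psd_sqr_sum.
have rc : r * c = - (c * p) by rewrite /r -mulrA cc mulrN.
have rrc : (r * r) * c = c * (p * p).
  by rewrite -mulrA rc mulrN [r * _]mulrA rc mulNr opprK -mulrA.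
have [s [s' [ps ps' ss ss' sc_]]] :=
  psd_sqrt_intertwine (psd_sqr (psd_adj pr)) (psd_sqr (psd_adj pp)) rrc.
have hs := psd_sqrt_uniq ps pr ss; have hs' := psd_sqrt_uniq ps' pp ss'.
have cpr : c * p = r * c by rewrite -hs' -sc_ hs.
have cp : c * p = 0 by apply: add_self_eq0; rewrite {1}cpr rc addNr.
apply: sa_sqr0; first exact: psd_adj pp.
by apply/eqP; rewrite -oppr_eq0 -mulNr -cc -mulrA cp mulr0.
Qed.

Lemma psd_conj y z : psd y -> psd (adj z * y * z).
Proof.
move=> /psd_sqrt [s [[as_ _] <- _]].
have -> : adj z * (s * s) * z = adj (s * z) * (s * z); last exact: psd_adjM.
by rewrite adjM as_ !mulrA.
Qed.

End Positivity.

(** * Approximate units *)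

Section ApproximateUnit.
Context {R : realType} {Ob : Type} {C : cstarCategory R Ob} {rho : Ob}.
Context {one : arrow C rho rho} {h1 : is_identity one}.
Local Notation B := (endo h1).
Implicit Types (a x y z h g : B) (r c e : R).

Lemma psd_exp g n : psd g -> psd (g ^+ n).
Proof.
move=> pg; elim: n => [|n IH]; first by rewrite expr0 -sc1; exact: psd_sc.
by rewrite exprS; apply: psdM => //; rewrite -exprS -exprSr.
Qed.

Lemma nrm_exp_le1 g n : nrm g <= 1 -> nrm (g ^+ n) <= 1.
Proof.
move=> hg; elim: n => [|n IH]; first by rewrite expr0 nrm1_le1.
rewrite exprS; apply: (le_trans (nrmM _ _)).
by rewrite mulr_ile1 ?nrm_ge0.
Qed.

Lemma psd_subr1 h : adj h = h -> nrm h <= 1 -> psd (1 - h).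
Proof. by rewrite -sc1; exact: psd_sc_sub. Qed.

Lemma nrm_subr1 h : psd h -> nrm h <= 1 -> nrm (1 - h) <= 1.
Proof. by rewrite -sc1; exact: psd_nrm_ball. Qed.

(* [sum_(k <= n) h (1 - h)^k = 1 - (1 - h)^(n+1) <= 1], and the terms decrease. *)
Lemma psd_sub_mul_pow h n : psd h -> nrm h <= 1 ->
  psd (1 - sc n.+1%:R * (h * (1 - h) ^+ n)).
Proof.
move=> ph hh; set g := 1 - h.
have pg : psd g by apply: psd_subr1 => //; exact: psd_adj.
have gh : GRing.comm g h by rewrite /GRing.comm /g mulrBl mulrBr mul1r mulr1.
have ghn m : GRing.comm g (h * g ^+ m).
  by apply: commrM => //; apply: commrX; exact: commr_refl.
elim: n => [|n IH].
  by rewrite sc1 mul1r expr0 mulr1.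
have -> : 1 - sc n.+2%:R * (h * g ^+ n.+1) =
    g * (1 - sc n.+1%:R * (h * g ^+ n)) + h * (1 - g ^+ n.+1).
  have -> : g * (1 - sc n.+1%:R * (h * g ^+ n)) =
      g - sc n.+1%:R * (h * g ^+ n.+1).
    rewrite mulrBr mulr1 [g * (_ * _)]mulrA -[g * sc _]scC -mulrA ghn.
    by rewrite -[h * _ * g]mulrA -exprSr.
  rewrite mulrBr mulr1 -[n.+2]addn1 natrD scD sc1 mulrDl mul1r opprD.
  by rewrite [RHS]addrACA /g subrK.
have gE m : psd (1 - g ^+ m).
  by apply: psd_subr1; [exact/psd_adj/psd_exp | exact/nrm_exp_le1/nrm_subr1].
apply: psdD; apply: psdM => //.
  apply: commrB; first exact: commr1.
  by apply: commrM => //; rewrite /GRing.comm scC.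
apply: commrB; first exact: commr1.
by apply/commrX/commr_sym.
Qed.

Lemma nrm_mul_pow h n : psd h -> nrm h <= 1 ->
  nrm (h * (1 - h) ^+ n) <= n.+1%:R^-1.
Proof.
move=> ph hh; have := psd_sub_mul_pow n ph hh; set x := h * _ => p.
have px : psd x.
  have gh : GRing.comm h (1 - h).
    by apply: commrB; [exact: commr1 | exact: commr_refl].
  apply: psdM => //; first exact: commrX.
  by apply: psd_exp; apply: psd_subr1 => //; exact: psd_adj.
have n0 : 0 < n.+1%:R :> R by rewrite ltr0Sn.
have := @psd_nrm_le _ _ _ _ _ _ (sc n.+1%:R * x) 1 ler01.
rewrite sc1 nrm_scM (ger0_norm (ltW n0)) -ler_pdivlMl// mulr1; apply=> //.
by apply: psd_scale => //; exact: ltW.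
Qed.

(** With [g = 1 - h], the square of the norm of [a g^n] is the norm of [g^n a^* a g^n], at most
    [1/c] times that of [h g^(2n)]. Then [nrm_mul_pow] gives [1/(2n+1)], weakened to [1/(n+1)]. *)
Lemma nrm_dominated_pow h a c n : psd h -> nrm h <= 1 -> 0 < c ->
  psd (h - sc c * (adj a * a)) ->
  nrm (a * (1 - h) ^+ n) ^+ 2 <= c^-1 * n.+1%:R^-1.
Proof.
move=> ph hh c0 pha; set g := 1 - h.
have pg : psd g by apply: psd_subr1 => //; exact: psd_adj.
have agn : adj (g ^+ n) = g ^+ n by apply/psd_adj/psd_exp.
rewrite -nrm_adjM adjM agn -ler_pdivrMl ?invr_gt0// invrK.
rewrite -(ger0_norm (ltW c0)) -nrm_scM.
have := @psd_nrm_mono _ _ _ _ _ _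
  (sc c * (g ^+ n * adj a * (a * g ^+ n))) (g ^+ n * h * g ^+ n).
have hgn : g ^+ n * h * g ^+ n = h * g ^+ (n + n).
  rewrite exprD mulrA; congr (_ * _); apply/esym/commrX.
  by apply: commrB; [exact: commr1 | exact: commr_refl].
move=> /(_ _ _)/le_trans; apply.
- apply: psd_scale; first exact: ltW.
  by rewrite -{1}agn -adjM; exact: psd_adjM.
- have -> : g ^+ n * h * g ^+ n - sc c * (g ^+ n * adj a * (a * g ^+ n)) =
      adj (g ^+ n) * (h - sc c * (adj a * a)) * g ^+ n.
    by rewrite agn mulrBr mulrBl !mulrA scC.
  exact: psd_conj.
- rewrite hgn; apply: (le_trans (nrm_mul_pow _ _ _)) => //.
  by rewrite lef_pV2 ?posrE ?ltr0Sn// ler_nat ltnS leq_addr.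
Qed.

(** Both products are summed because [a^* a] controls [a - a u] while [a a^*], through [a^*],
    controls [a - u a]. *)
Definition sqr_sum (l : seq B) : B := \sum_(a <- l) (adj a * a + a * adj a).

Lemma psd_sqr_sum_sub (l : seq B) a : a \in l ->
  psd (sqr_sum l - (adj a * a + a * adj a)).
Proof.
have hp (b : B) : psd (adj b * b + b * adj b).
  by apply: psdD; [exact: psd_adjM | rewrite -{1}[b]adjK; exact: psd_adjM].
have hl (s : seq B) : psd (sqr_sum s).
  elim: s => [|b s IH]; first by rewrite /sqr_sum big_nil; exact: psd0.
  by rewrite /sqr_sum big_cons; apply: psdD.
elim: l => // b l IH; rewrite inE => /orP[/eqP ->|/IH {}IH].
  by rewrite /sqr_sum big_cons addrC addKr; exact: hl.
by rewrite /sqr_sum big_cons -addrA; apply: psdD.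
Qed.

(* The approximate unit is [1 - (1 - h)^n], squared, where [h] dominates a
   multiple of all [a^* a] and [a a^*]; having no constant term, it stays in the
   ideal. *)
Lemma ideal_approximate_unit (I : B -> Prop) (l : seq B) e :
  I 0 -> (forall x y, I x -> I y -> I (x + y)) ->
  (forall x y, I x -> I (x * y)) -> (forall x y, I y -> I (x * y)) ->
  (forall a, a \in l -> I a) -> 0 < e ->
  exists u, [/\ I u, adj u = u, nrm (u * u) <= 1 &
    forall a, a \in l -> nrm (a - a * (u * u)) <= e /\
                         nrm (a - (u * u) * a) <= e].
Proof.
move=> I0 ID Ir Il hl e0; pose H := sqr_sum l.
have IH : I H.
  rewrite /H /sqr_sum; elim: l hl {H} => [|a l IHl] hl; first by rewrite big_nil.
  rewrite big_cons; apply: (ID).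
    by have ha := hl a (mem_head _ _); apply: ID; [exact: Il | exact: Ir].
  by apply: IHl => b hb; apply: hl; rewrite inE hb orbT.
pose m := nrm H + 1; have m0 : 0 < m by have := nrm_ge0 H; rewrite /m; lra.
pose h := sc m^-1 * H.
have pp (b : B) : psd (adj b * b) /\ psd (b * adj b).
  by split; [exact: psd_adjM | rewrite -{1}[b]adjK; exact: psd_adjM].
have pH : psd H.
  rewrite /H /sqr_sum; elim: (l) => [|b s IHs]; first by rewrite big_nil; exact: psd0.
  by have [? ?] := pp b; rewrite big_cons; apply: psdD => //; apply: psdD.
have ph : psd h by apply: psd_scale => //; rewrite invr_ge0 ltW.
have hh : nrm h <= 1.
  rewrite nrm_scM ger0_norm ?invr_ge0 ?(ltW m0)// ler_pdivrMl// mulr1 /m; lra.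
have hdom (a : B) : a \in l ->
    psd (h - sc m^-1 * (adj a * a)) /\
    psd (h - sc m^-1 * (adj (adj a) * adj a)).
  move=> /psd_sqr_sum_sub; rewrite -/H adjK => p; have [p1 p2] := pp a.
  have mi : 0 <= m^-1 by rewrite invr_ge0 ltW.
  rewrite /h -!mulrBr; split; apply: psd_scale => //.
    by rewrite -(subrK (a * adj a) (H - _)) -[H - _ - _]addrA -opprD; exact: psdD.
  rewrite -(subrK (adj a * a) (H - _)) -[H - _ - _]addrA -opprD [a * _ + _]addrC.
  exact: psdD.
set g := 1 - h.
(* The error [a (1 - u^2) = a g^n (1 + u)] has norm at most twice that of [a g^n], hence the target
   [e / 2]; the factor [m] comes from the scaling of [H]. *)
have [n hn] : exists n : nat, m * n.+1%:R^-1 <= (e / 2) ^+ 2.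
  have d0 : 0 < (e / 2) ^+ 2 / m by rewrite divr_gt0// exprn_gt0// divr_gt0.
  exists (Num.truncn (m^-1 * (e / 2) ^+ 2)^-1).
  rewrite -ler_pdivlMl// -[leRHS]invrK.
  rewrite lef_pV2 ?posrE ?ltr0Sn//; last by rewrite invr_gt0 mulrC.
  by apply/ltW; rewrite truncnS_gt.
have agn (a : B) : a \in l -> nrm (a * g ^+ n) <= e / 2 /\
                        nrm (adj a * g ^+ n) <= e / 2.
  move=> /hdom[d1 d2]; have m1 : 0 < m^-1 by rewrite invr_gt0.
  have e2 : 0 <= e / 2 by lra.
  by split; rewrite -(@ler_pXn2r _ 2) ?nnegrE ?nrm_ge0//;
    apply: (le_trans (nrm_dominated_pow _ ph hh m1 _)); rewrite ?invrK.
have pgn : psd (g ^+ n) by apply/psd_exp/psd_subr1 => //; exact: psd_adj.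
have hgn : nrm (g ^+ n) <= 1 by apply/nrm_exp_le1/nrm_subr1.
(* Positivity of an arrow of the ideal asks for a root in the ideal. The approximant is therefore
   the square of [u], which lies there. *)
pose u := 1 - g ^+ n; have au : adj u = u by rewrite adjB adj1 psd_adj.
have hu : nrm u <= 1 by exact: nrm_subr1.
have E (v : B) : 1 - v * v = (1 - v) * (1 + v).
  by rewrite mulrDr mulr1 [(1 - v) * v]mulrBl mul1r addrA subrK.
have key (a : B) : nrm (a * g ^+ n) <= e / 2 -> nrm (a - a * (u * u)) <= e.
  move=> ha; have -> : a - a * (u * u) = a * g ^+ n * (1 + u).
    by rewrite -{1}[a]mulr1 -mulrBr E mulrA /u subKr.
  apply: (le_trans (nrmM _ _)).
  have := nrmD (1 : B) u; have := @nrm1_le1 _ _ _ _ _ h1.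
  by have := nrm_ge0 (a * g ^+ n); have := nrm_ge0 (1 + u : B); nra.
exists u; split=> //.
- rewrite /u; elim: (n) => [|k IHk]; first by rewrite expr0 subrr.
  have -> : 1 - g ^+ k.+1 = (1 - g ^+ k) + h * g ^+ k.
    by rewrite exprS {2}/g mulrBl mul1r opprB addrA addrAC.
  by apply: ID => //; apply: Ir; exact: Il.
- by rewrite nrm_sq// expr_le1// nrm_ge0.
- move=> a /agn[d1 d2]; split; first exact: key.
  by rewrite -nrm_adj adjB !adjM au; exact: key.
Qed.

End ApproximateUnit.

(** * Multipliers *)

Section Multipliers.
Context {R : realType} {Ob : Type} (C : cstarCategory R Ob).
Implicit Types rho sigma tau : Ob.

Lemma acomp_rcancel rho sigma (x y : arrow C rho sigma) :
  (forall a : arrow C rho rho, acomp x a = acomp y a) -> x = y.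
Proof.
move=> h; apply/eqP; rewrite -subr_eq0; apply/eqP.
by apply: cstar_faithful => a; rewrite acompBl h subrr.
Qed.

Lemma acomp_lcancel rho sigma (x y : arrow C rho sigma) :
  (forall c : arrow C sigma sigma, acomp c x = acomp c y) -> x = y.
Proof.
move=> h; rewrite -(astarK (cstarP C) x) -(astarK (cstarP C) y); congr astar.
apply: acomp_rcancel => a; rewrite -(astarK (cstarP C) a).
by rewrite -!(astar_comp (cstarP C)) h.
Qed.

Lemma star_comp_eq0 rho sigma (x : arrow C rho sigma) :
  acomp (astar x) x = 0 -> x = 0.
Proof.
move=> h; apply: nrm0_eq0; apply/eqP.
by rewrite -sqrf_eq0 -nrm_cstar h nrm0.
Qed.

Section Linear.
Context {rho sigma : Ob} (T : multiplier C rho sigma).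

Lemma multl_lin k a b : multl T (k *: a + b) = k *: multl T a + multl T b.
Proof. exact: (multl_linear (multiplierP T)). Qed.

Lemma multl0 : multl T 0 = 0.
Proof.
have := multl_lin 1 0 0; rewrite !scale1r !addr0 => /eqP.
by rewrite -subr_eq0 opprD addNKr oppr_eq0 => /eqP.
Qed.

Lemma multlDr a b : multl T (a + b) = multl T a + multl T b.
Proof. by have := multl_lin 1 a b; rewrite !scale1r. Qed.

Lemma multlZr k a : multl T (k *: a) = k *: multl T a.
Proof. by have := multl_lin k a 0; rewrite multl0 !addr0. Qed.

Lemma multlBr a b : multl T (a - b) = multl T a - multl T b.
Proof. by rewrite multlDr -scaleN1r multlZr scaleN1r. Qed.

Lemma nrm_multl a : nrm (multl T a) <= nrm T * nrm a.
Proof.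
have [->|a0] := eqVneq a 0; first by rewrite multl0 !nrm0 mulr0.
have na : 0 < nrm a.
  by rewrite lt_neqAle nrm_ge0 andbT eq_sym; apply: contraNneq a0 => /nrm0_eq0 ->.
have h : `| (nrm a)^-1%:C%C *: a| <= 1.
  by rewrite nrmE lecR nrmZr ger0_norm ?invr_ge0 ?nrm_ge0// mulVf// gt_eqF.
have := multiplier_rnorm_ub T h.
rewrite multlZr -/(nrm _) nrmZr ger0_norm ?invr_ge0 ?nrm_ge0//.
by rewrite ler_pdivrMl// mulrC.
Qed.

Lemma nrm_multiplier_le (k : R) : 0 <= k ->
  (forall a, nrm (multl T a) <= k * nrm a) -> nrm T <= k.
Proof.
move=> k0 h; apply: multiplier_rnorm_le => a; rewrite nrmE lecR => a1.
by apply: (le_trans (h a)); rewrite ler_piMr.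
Qed.

Lemma multr_star (b : arrow C sigma sigma) :
  multr T b = astar (multl (multiplier_star T) (astar b)).
Proof. by rewrite /multiplier_star /multl /= !(astarK (cstarP C)). Qed.

Lemma multl_star (b : arrow C sigma sigma) :
  multl (multiplier_star T) b = astar (multr T (astar b)).
Proof. by []. Qed.

Lemma multr_starE (a : arrow C rho rho) :
  multr (multiplier_star T) a = astar (multl T (astar a)).
Proof. by []. Qed.

End Linear.

(** Since [(b T) a = b (T a)], the right map is determined by the left one, so equalities of
    multipliers need checking on [multl] only. *)
Lemma multl_inj rho sigma (T S : multiplier C rho sigma) :
  multl T =1 multl S -> T = S.
Proof.
move=> h; apply: eq_multiplier => // b; apply: acomp_rcancel => a.
by rewrite -!(mult_middle (multiplierP _)) h.
Qed.

Lemma multiplier_starK rho sigma (T : multiplier C rho sigma) :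
  multiplier_star (multiplier_star T) = T.
Proof.
by apply: multl_inj => a; rewrite multl_star multr_starE !(astarK (cstarP C)).
Qed.

Lemma multiplier_star_antilinear rho sigma k (T S : multiplier C rho sigma) :
  multiplier_star (k *: T + S) =
  conjc k *: multiplier_star T + multiplier_star S.
Proof.
apply: multl_inj => b; rewrite multlD multlZ !multl_star.
exact: (astar_antilinear (cstarP C)).
Qed.

Lemma multl_of rho sigma (t : arrow C rho sigma) a :
  multl (multiplier_of C rho sigma t) a = acomp t a.
Proof. by []. Qed.

Lemma multr_of rho sigma (t : arrow C rho sigma) b :
  multr (multiplier_of C rho sigma t) b = acomp b t.
Proof. by []. Qed.

Lemma multiplier_of_linear rho sigma : linear (multiplier_of C rho sigma).
Proof.
move=> k t u; apply: multl_inj => a.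
by rewrite multlD multlZ !multl_of acompDl acompZl.
Qed.

Lemma multiplier_of_star rho sigma (t : arrow C rho sigma) :
  multiplier_star (multiplier_of C _ _ t) = multiplier_of C _ _ (astar t).
Proof.
apply: multl_inj => b; rewrite multl_star multr_of multl_of.
by rewrite (astar_comp (cstarP C)) (astarK (cstarP C)).
Qed.

Lemma nrm_multiplier_of rho sigma (t : arrow C rho sigma) :
  nrm (multiplier_of C _ _ t) = nrm t.
Proof.
have [->|t0] := eqVneq t 0.
  have -> : multiplier_of C rho sigma 0 = 0.
    by apply: multl_inj => a; rewrite multl_of acomp0l.
  by rewrite !nrm0.
have nt : 0 < nrm t.
  by rewrite lt_neqAle nrm_ge0 andbT eq_sym; apply: contraNneq t0 => /nrm0_eq0 ->.
apply/eqP; rewrite eq_le; apply/andP; split.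
  by apply: nrm_multiplier_le; [exact: nrm_ge0 | move=> a; exact: nrm_comp].
(* The supremum is attained at [a = t^* t]. *)
have := nrm_multl (multiplier_of C _ _ t) (acomp (astar t) t).
rewrite multl_of nrm_cstar => h.
have h3 : nrm t ^+ 4 <= nrm t * nrm (acomp t (acomp (astar t) t)).
  rewrite (exprM _ 2 2) -[X in X ^+ 2]nrm_cstar -[leLHS]nrm_cstar.
  rewrite (astar_comp (cstarP C)) (astarK (cstarP C)) -(acompA (cstarP C)).
  by apply: (le_trans (nrm_comp _ _)); rewrite nrm_astar.
have h4 := le_trans h3 (ler_wpM2l (ltW nt) h).
rewrite -(ler_pM2r (exprn_gt0 3 nt)) -exprS (le_trans h4)//.
by rewrite mulrCA -exprS.
Qed.

Lemma multiplier_of_inj rho sigma : injective (multiplier_of C rho sigma).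
Proof.
move=> t u /(congr1 (@multl _ _ _ _ _)) h.
by apply: acomp_rcancel => a; have := congr1 (@^~ a) h.
Qed.

End Multipliers.

(* Extension of the multipliers between the objects [f i] to arrows with any
   source [f i], and not only to endomorphisms. *)
Record is_mult_action {R : realType} {Ob : Type} (C : cstarCategory R Ob)
    (Ix : Type) (f : Ix -> Ob)
    (act : forall i j k : Ix, multiplier C (f j) (f k) ->
       arrow C (f i) (f j) -> arrow C (f i) (f k)) : Prop := IsMultAction {
  act_middle : forall (i j k : Ix) (S : multiplier C (f j) (f k))
    (t : arrow C (f i) (f j)) (c : arrow C (f k) (f k)),
    acomp c (act i j k S t) = acomp (multr S c) t;
  act_nrm : forall (i j k : Ix) (S : multiplier C (f j) (f k))
    (t : arrow C (f i) (f j)), nrm (act i j k S t) <= nrm S * nrm t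
}.

(** * Composition of multipliers from an abstract action *)

Section Action.
Context {R : realType} {Ob : Type} {C : cstarCategory R Ob}.
Context {Ix : Type} {f : Ix -> Ob}.
Context {act : forall i j k : Ix, multiplier C (f j) (f k) ->
  arrow C (f i) (f j) -> arrow C (f i) (f k)}.
Context (actP : is_mult_action act).
Implicit Types i j k l : Ix.

Local Notation "S @* t" := (@act _ _ _ S t) (at level 40).
Local Notation M i j := (multiplier C (f i) (f j)).
Local Notation A i j := (arrow C (f i) (f j)).

Lemma act_multl i j (S : M i j) (a : A i i) : S @* a = multl S a.
Proof.
apply: acomp_lcancel => c.
by rewrite (act_middle actP) (mult_middle (multiplierP S)).
Qed.

Lemma act_linear i j k (S : M j k) : linear (@act i j k S).
Proof.
move=> c t u; apply: acomp_lcancel => b.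
by rewrite acompDr acompZr !(act_middle actP) acompDr acompZr.
Qed.

Lemma act_acomp i j k l (S : M k l) (t : A j k) (u : A i j) :
  S @* (acomp t u) = acomp (S @* t) u.
Proof.
apply: acomp_lcancel => b.
by rewrite (act_middle actP) !(acompA (cstarP C)) (act_middle actP).
Qed.

Lemma act_of i j k (s : A j k) (t : A i j) :
  multiplier_of C _ _ s @* t = acomp s t.
Proof.
apply: acomp_lcancel => b.
by rewrite (act_middle actP) multr_of (acompA (cstarP C)).
Qed.

(** The right action is the left one conjugated by the involution, so that [is_mult_action] has to
    provide one side only. *)
Definition ract i j k (t : A j k) (T : M i j) : A i k :=
  astar (multiplier_star T @* astar t).

Local Notation "t *@ T" := (ract t T) (at level 40).

Lemma ract_middle i j k (t : A j k) (T : M i j) (a : A i i) :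
  acomp (t *@ T) a = acomp t (multl T a).
Proof.
rewrite -[LHS](astarK (cstarP C)) (astar_comp (cstarP C)) (astarK (cstarP C)).
rewrite (act_middle actP) multr_starE -(astar_comp (cstarP C)).
by rewrite !(astarK (cstarP C)).
Qed.

Lemma nrm_ract i j k (t : A j k) (T : M i j) :
  nrm (t *@ T) <= nrm t * nrm (multiplier_star T).
Proof. by rewrite nrm_astar mulrC -(nrm_astar t) (act_nrm actP). Qed.

Lemma ract_linear i j k (T : M i j) : linear (fun t : A j k => t *@ T).
Proof.
move=> c t u; apply: acomp_rcancel => a.
by rewrite acompDl acompZl !ract_middle acompDl acompZl.
Qed.

Lemma ract_acomp i j k l (t : A k l) (u : A j k) (T : M i j) :
  (acomp t u) *@ T = acomp t (u *@ T).
Proof.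
apply: acomp_rcancel => a.
by rewrite -(acompA (cstarP C)) !ract_middle (acompA (cstarP C)).
Qed.

Lemma ract_multr i j (c : A j j) (T : M i j) : c *@ T = multr T c.
Proof.
apply: acomp_rcancel => a.
by rewrite ract_middle (mult_middle (multiplierP T)).
Qed.

(* Both sides agree after composition with [t^*] on the right or with [s^*] on
   the left, so their difference [x] satisfies [x x^* x = 0]. *)
Lemma act_ract i j k l (s : A k l) (T : M j k) (t : A i j) :
  acomp s (T @* t) = acomp (s *@ T) t.
Proof.
have cC := cstarP C.
apply/eqP; rewrite -subr_eq0; apply/eqP; set x := _ - _.
have xt : acomp x (astar t) = 0.
  rewrite acompBl -!(acompA cC) -act_acomp act_multl ract_middle.
  by rewrite subrr.
have sx : acomp (astar s) x = 0.
  rewrite acompBr !(acompA cC) -ract_acomp ract_multr.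
  by rewrite -(act_middle actP) subrr.
have xxx : acomp x (acomp (astar x) x) = 0.
  rewrite {2}/x astarB !(astar_comp cC) acompBl acompBr -!(acompA cC) sx acomp0r.
  by rewrite acomp0r sub0r [acomp x _](acompA cC) xt acomp0l oppr0.
apply: star_comp_eq0; apply: star_comp_eq0.
by rewrite (astar_comp cC) (astarK cC) -(acompA cC) xxx acomp0r.
Qed.

Lemma mult_comp_subproof i j k (S : M j k) (T : M i j) :
  is_multiplier (fun a => S @* multl T a) (fun c => multr S c *@ T).
Proof.
split.
- by move=> c a b; rewrite multl_lin act_linear.
- exists ((nrm S * nrm T)%:C%C) => a; rewrite !nrmE -rmorphM lecR -mulrA.
  apply: (le_trans (act_nrm actP _ _)).
  by rewrite ler_wpM2l ?nrm_ge0// nrm_multl.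
- by move=> a a'; rewrite (multl_comp (multiplierP T)) act_acomp.
- by move=> c a b; rewrite (multr_linear (multiplierP S)) ract_linear.
(* The bound involves [T^*] because the equality of the norms of [T] and [T^*] is deduced later,
   from this very composition. *)
- have /bounded_map_ge0[q q0 hq] := multr_bounded (multiplierP S).
  exists (q * `|multiplier_star T|) => c.
  have := nrm_ract (multr S c) T.
  rewrite -lecR rmorphM /= -!nrmE => /le_trans; apply.
  by rewrite mulrAC; apply: ler_wpM2r.
- by move=> b' b; rewrite (multr_comp (multiplierP S)) ract_acomp.
- by move=> a b; rewrite (act_middle actP) ract_middle.
Qed.

Definition mult_comp i j k (S : M j k) (T : M i j) : M i k :=
  mk_multiplier (mult_comp_subproof S T).

Lemma multl_mult_comp i j k (S : M j k) (T : M i j) a :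
  multl (mult_comp S T) a = S @* multl T a.
Proof. by []. Qed.

Lemma multr_mult_comp i j k (S : M j k) (T : M i j) c :
  multr (mult_comp S T) c = multr S c *@ T.
Proof. by []. Qed.

(** After multiplication by [c] both sides become [((c S) T) t], the regrouping being [act_ract].
    Associativity of composition follows from this. *)
Lemma act_mult_comp i j k l (S : M k l) (T : M j k) (t : A i j) :
  mult_comp S T @* t = S @* (T @* t).
Proof.
apply: acomp_lcancel => c.
by rewrite !(act_middle actP) multr_mult_comp act_ract.
Qed.

Lemma mult_compA i j k l (Q : M k l) (S : M j k) (T : M i j) :
  mult_comp Q (mult_comp S T) = mult_comp (mult_comp Q S) T.
Proof. by apply: multl_inj => a; rewrite !multl_mult_comp act_mult_comp. Qed.

Lemma mult_comp_star i j k (S : M j k) (T : M i j) :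
  multiplier_star (mult_comp S T) =
  mult_comp (multiplier_star T) (multiplier_star S).
Proof.
apply: multl_inj => c.
rewrite multl_star multr_mult_comp multl_mult_comp multl_star.
by rewrite /ract (astarK (cstarP C)).
Qed.

Lemma mult_comp_of i j k (S : M j k) (t : A i j) :
  mult_comp S (multiplier_of C _ _ t) = multiplier_of C _ _ (S @* t).
Proof.
by apply: multl_inj => a; rewrite multl_mult_comp !multl_of act_acomp.
Qed.

Lemma mult_of_comp i j k (t : A j k) (T : M i j) :
  mult_comp (multiplier_of C _ _ t) T = multiplier_of C _ _ (t *@ T).
Proof.
by apply: multl_inj => a; rewrite multl_mult_comp multl_of act_of ract_middle.
Qed.

Lemma nrm_mult_comp i j k (S : M j k) (T : M i j) :
  nrm (mult_comp S T) <= nrm S * nrm T.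
Proof.
apply: nrm_multiplier_le; first by rewrite mulr_ge0 ?nrm_ge0.
move=> a; rewrite multl_mult_comp -mulrA.
apply: (le_trans (act_nrm actP _ _)).
by rewrite ler_wpM2l ?nrm_ge0// nrm_multl.
Qed.

Lemma nrm_sqr_le_mult_star i j (T : M i j) :
  nrm T ^+ 2 <= nrm (mult_comp (multiplier_star T) T).
Proof.
set P := mult_comp _ _.
suff : nrm T <= Num.sqrt (nrm P).
  by move=> h; rewrite -[leRHS]sqr_sqrtr ?nrm_ge0// ler_pXn2r ?nnegrE ?nrm_ge0 ?sqrtr_ge0.
apply: nrm_multiplier_le => [|a]; first exact: sqrtr_ge0.
rewrite -(@ler_pXn2r _ 2) ?nnegrE ?mulr_ge0 ?nrm_ge0 ?sqrtr_ge0//.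
rewrite exprMn sqr_sqrtr ?nrm_ge0// -nrm_cstar.
have -> : acomp (astar (multl T a)) (multl T a) = acomp (astar a) (multl P a).
  by rewrite multl_mult_comp (act_middle actP) multr_starE (astarK (cstarP C)).
apply: (le_trans (nrm_comp _ _)); rewrite nrm_astar expr2 mulrCA.
by rewrite ler_wpM2l ?nrm_ge0// nrm_multl.
Qed.

(** From [|S|^2 <= |S^* S| <= |S^*| |S|] divide by [|S|], and do the same for [S^*]. Only now do the
    right maps get their bound [nrm_multr]. *)
Lemma nrm_multiplier_star i j (T : M i j) : nrm (multiplier_star T) = nrm T.
Proof.
suff main k l (S : M k l) : nrm S <= nrm (multiplier_star S).
  by apply/eqP; rewrite eq_le main andbT -{2}[T]multiplier_starK main.
have := le_trans (nrm_sqr_le_mult_star S) (nrm_mult_comp _ _).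
have [->|S0] := eqVneq S 0; first by rewrite nrm0 nrm_ge0.
rewrite expr2 ler_pM2r// lt_neqAle nrm_ge0 andbT eq_sym.
by apply: contraNneq S0 => /nrm0_eq0 ->.
Qed.

Lemma nrm_mult_cstar i j (T : M i j) :
  nrm (mult_comp (multiplier_star T) T) = nrm T ^+ 2.
Proof.
apply/eqP; rewrite eq_le nrm_sqr_le_mult_star andbT expr2.
by rewrite -[X in _ <= X * _]nrm_multiplier_star nrm_mult_comp.
Qed.

Lemma nrm_multr i j (T : M i j) b : nrm (multr T b) <= nrm T * nrm b.
Proof.
rewrite multr_star nrm_astar -(nrm_multiplier_star T) -(nrm_astar b).
exact: nrm_multl.
Qed.

Lemma mult_comp_linear_left i j k (T : M i j) :
  linear (fun S : M j k => mult_comp S T).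
Proof.
move=> c S Q; apply: multl_inj => a.
rewrite multlD multlZ !multl_mult_comp; apply: acomp_lcancel => b.
rewrite acompDr acompZr !(act_middle actP) -acompZl -acompDl.
by [].
Qed.

Lemma mult_comp_linear_right i j k (S : M j k) :
  linear (fun T : M i j => mult_comp S T).
Proof.
move=> c T Q; apply: multl_inj => a.
rewrite multlD multlZ !multl_mult_comp multlD multlZ.
exact: act_linear.
Qed.

End Action.

(** * Completeness of the spaces of multipliers *)

Section Completeness.
Context {R : realType} {Ob : Type} (C : cstarCategory R Ob).

Lemma ball_nrm (V : normedModType R[i]) (x y : V) (e : R) :
  ball x e%:C%C y = (nrm (x - y) < e) :> Prop.
Proof. by rewrite -ball_normE /ball_ /= nrmE ltcR. Qed.

Lemma cvg_nrmP (V : normedModType R[i]) (T : Type) (F : set_system T)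
    (FF : Filter F) (g : T -> V) (l : V) :
  (forall e : R, 0 < e -> \forall x \near F, nrm (l - g x) < e) <->
  g x @[x --> F] --> l.
Proof.
split=> [h|h e e0].
  apply/cvgrPdist_lt => e e0.
  have er : e = (complex.Re e)%:C%C by rewrite RRe_real// gtr0_real.
  move: e0; rewrite er ltcR => /h; apply: filterS => x.
  by rewrite -ltcR -nrmE.
have e0' : 0 < e%:C%C by rewrite ltcR.
have /cvgrPdist_lt/(_ _ e0') := h; apply: filterS => x.
by rewrite nrmE ltcR.
Qed.

Lemma nrm_cauchyP (V : normedModType R[i]) (F : set_system V)
    (FF : ProperFilter F) :
  cauchy F <->
  forall e : R, 0 < e -> exists x, \forall y \near F, nrm (x - y) < e.
Proof.
split=> [/cauchyP h e e0|h].
  have e0' : 0 < e%:C%C by rewrite ltcR.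
  have [x hx] := h _ e0'; exists x.
  by apply: filterS hx => y; rewrite ball_nrm.
apply/cauchy_exP => e e0.
have er : e = (complex.Re e)%:C%C by rewrite RRe_real// gtr0_real.
move: e0; rewrite er ltcR => /h[x hx]; exists x.
by apply: filterS hx => y; rewrite ball_nrm.
Qed.

Lemma nrm_le_eps (V : normedModType R[i]) (x : V) (c : R) :
  (forall e, 0 < e -> nrm x <= e * c) -> x = 0.
Proof.
move=> h; apply: nrm_le0; apply/ler_addgt0Pr => e e0; rewrite add0r.
have d0 : 0 < `|c| + 1 by rewrite ltr_wpDl.
apply: (le_trans (h _ (divr_gt0 e0 d0))).
rewrite -mulrA; apply: ler_piMr; first exact: ltW.
rewrite ler_pdivrMl// mulr1.
by rewrite (le_trans (ler_norm c))// lerDl.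
Qed.

Lemma nrm_distD (V : normedModType R[i]) (x y z : V) :
  nrm (x - z) <= nrm (x - y) + nrm (y - z).
Proof. by rewrite -(subrKA y x (- z)) nrmD. Qed.

Section Limit.
Context {rho sigma : Ob}.
Context (L : arrow C rho rho -> arrow C rho sigma).
Context (Q : arrow C sigma sigma -> arrow C rho sigma).
Context (approx : forall e : R, 0 < e -> exists T : multiplier C rho sigma,
  (forall a, nrm (L a - multl T a) <= e * nrm a) /\
  (forall b, nrm (Q b - multr T b) <= e * nrm b)).

Lemma approx_linear (V W : normedModType R[i]) (g : V -> W) :
  (forall e : R, 0 < e -> exists2 h : V -> W, linear h &
     forall a, nrm (g a - h a) <= e * nrm a) -> linear g.
Proof.
move=> happ k a b; apply/eqP; rewrite -subr_eq0; apply/eqP.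
apply: (@nrm_le_eps _ _ (nrm (k *: a + b) + complex.Re `|k| * nrm a + nrm b)).
move=> e e0; have [h hl hh] := happ e e0.
have -> : g (k *: a + b) - (k *: g a + g b) =
   (g (k *: a + b) - h (k *: a + b)) - (k *: (g a - h a) + (g b - h b)).
  rewrite hl scalerBr [k *: g a - _ + _]addrACA -opprD.
  by rewrite [- (_ - _)]opprB addrA subrK.
apply: (le_trans (nrmD _ _)); rewrite nrmN.
have h3 := nrmD (k *: (g a - h a)) (g b - h b); rewrite nrmZ in h3.
have h4 := hh (k *: a + b); have h5 := hh b.
have k0 : 0 <= complex.Re `|k| by rewrite -ler0c Re_cnormK.
have h6 := ler_wpM2l k0 (hh a).
by rewrite !mulrDr mulrCA; lra.
Qed.

Lemma approx_bounded (V W : normedModType R[i]) (g : V -> W) :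
  (exists2 h : V -> W, bounded_map h &
     forall a, nrm (g a - h a) <= 1 * nrm a) -> bounded_map g.
Proof.
move=> [h [k hk] hh]; exists (k + 1) => a.
rewrite -(subrK (h a) (g a)) addrC mulrDl; apply: (le_trans (ler_normD _ _)).
by apply: lerD => //; rewrite !nrmE -rmorphM lecR.
Qed.

(** Boundedness apart, each axiom says that a defect vanishes; the defect of [L] and [Q] is that of
    an exact multiplier, which is zero, plus errors proportional to [e]. *)
Lemma approx_is_multiplier : is_multiplier L Q.
Proof.
split.
- apply: approx_linear => e /approx[T [hl _]]; exists (multl T) => //.
  exact: (multl_linear (multiplierP T)).
- apply: approx_bounded; have [T [hl _]] := approx ltr01; exists (multl T) => //.
  exact: (multl_bounded (multiplierP T)).
- move=> a a'; apply/eqP; rewrite -subr_eq0; apply/eqP.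
  apply: (@nrm_le_eps _ _ (nrm (acomp a a') + nrm a * nrm a')) => e e0.
  have [T [hl _]] := approx e0.
  have -> : L (acomp a a') - acomp (L a) a' =
     (L (acomp a a') - multl T (acomp a a')) - acomp (L a - multl T a) a'.
    by rewrite (multl_comp (multiplierP T)) acompBl opprB addrA subrK.
  apply: (le_trans (nrmD _ _)); rewrite nrmN mulrDr lerD//.
  apply: (le_trans (nrm_comp _ _)).
  by rewrite mulrA ler_wpM2r ?nrm_ge0.
- apply: approx_linear => e /approx[T [_ hr]]; exists (multr T) => //.
  exact: (multr_linear (multiplierP T)).
- apply: approx_bounded; have [T [_ hr]] := approx ltr01; exists (multr T) => //.
  exact: (multr_bounded (multiplierP T)).
- move=> b b'; apply/eqP; rewrite -subr_eq0; apply/eqP.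
  apply: (@nrm_le_eps _ _ (nrm (acomp b b') + nrm b * nrm b')) => e e0.
  have [T [_ hr]] := approx e0.
  have -> : Q (acomp b b') - acomp b (Q b') =
     (Q (acomp b b') - multr T (acomp b b')) - acomp b (Q b' - multr T b').
    by rewrite (multr_comp (multiplierP T)) acompBr opprB addrA subrK.
  apply: (le_trans (nrmD _ _)); rewrite nrmN mulrDr lerD//.
  apply: (le_trans (nrm_comp _ _)).
  by rewrite mulrCA ler_wpM2l ?nrm_ge0.
- move=> a b; apply/eqP; rewrite -subr_eq0; apply/eqP.
  apply: (@nrm_le_eps _ _ (nrm b * nrm a + nrm b * nrm a)) => e e0.
  have [T [hl hr]] := approx e0.
  have -> : acomp b (L a) - acomp (Q b) a =
     acomp b (L a - multl T a) - acomp (Q b - multr T b) a.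
    by rewrite acompBl acompBr (mult_middle (multiplierP T)) opprB addrA subrK.
  apply: (le_trans (nrmD _ _)); rewrite nrmN mulrDr lerD//;
    apply: (le_trans (nrm_comp _ _)).
    by rewrite mulrCA ler_wpM2l ?nrm_ge0.
  by rewrite mulrA ler_wpM2r ?nrm_ge0.
Qed.

End Limit.

(** Evaluation at a point is Lipschitz, hence maps Cauchy filters to Cauchy filters. The estimate is
    uniform in [x], which later turns pointwise limits into convergence in operator norm. *)
Lemma pointwise_limit (V W X : normedModType R[i]) (ev : V -> X -> W)
    (F : set_system V) :
  (forall G : set_system W, ProperFilter G -> cauchy G -> cvg G) ->
  (forall T S x, nrm (ev T x - ev S x) <= nrm (T - S) * nrm x) ->
  ProperFilter F -> cauchy F ->
  exists l : X -> W, forall (e : R) (T : V),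
    (\forall S \near F, nrm (T - S) < e) ->
    forall x, nrm (l x - ev T x) <= e * nrm x.
Proof.
move=> compl hev FF /nrm_cauchyP hF.
have hc x : cvg (ev T x @[T --> F]).
  apply: compl; apply/nrm_cauchyP => e e0.
  have d0 : 0 < nrm x + 1 by have := nrm_ge0 x; lra.
  have [T hT] := hF _ (divr_gt0 e0 d0); exists (ev T x).
  apply: filterS hT => S hS; apply: (le_lt_trans (hev _ _ _)).
  have := nrm_ge0 x; rewrite ltr_pdivlMr// in hS; have := nrm_ge0 (T - S); nra.
exists (fun x => lim (ev T x @[T --> F])) => e T hT x.
apply/ler_addgt0Pr => d d0.
have /cvg_nrmP/(_ d d0) h := hc x.
have [S [hS1 hS2]] : exists S, nrm (lim (ev T x @[T --> F]) - ev S x) < d /\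
    nrm (T - S) < e.
  exact: (filter_ex (filterI h hT)).
apply: (le_trans (nrm_distD _ (ev S x) _)); rewrite addrC lerD//; last exact: ltW.
apply: (le_trans (hev _ _ _)); rewrite nrmB ler_wpM2r ?nrm_ge0//; exact: ltW.
Qed.

(** The norm sees [multl] only, so control of [multr] is a hypothesis, supplied by [nrm_multr] once
    an action is given. *)
Lemma multiplier_complete rho sigma :
  (forall (T : multiplier C rho sigma) b, nrm (multr T b) <= nrm T * nrm b) ->
  forall F : set_system (multiplier C rho sigma),
    ProperFilter F -> cauchy F -> cvg F.
Proof.
move=> hr F FF cF; have compl := arrow_complete (cstarP C).
have [L hL] := pointwise_limit (compl rho sigma)
  (fun T S a => nrm_multl (T - S) a) FF cF.
have [Q hQ] := pointwise_limit (compl rho sigma)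
  (fun T S b => hr (T - S) b) FF cF.
have /nrm_cauchyP hF := cF.
have happ e : 0 < e -> exists T : multiplier C rho sigma,
    (forall a, nrm (L a - multl T a) <= e * nrm a) /\
    (forall b, nrm (Q b - multr T b) <= e * nrm b).
  by move=> /hF[T hT]; exists T; split; [exact: hL | exact: hQ].
pose U := mk_multiplier (approx_is_multiplier happ).
apply/cvg_ex; exists U; apply/cvg_nrmP => e e0.
have [T hT] := hF _ (divr_gt0 e0 (ltr0n _ 2)).
apply: filterS (hT) => S hS.
apply: (le_lt_trans (nrm_distD _ T _)).
have : nrm (U - T) <= e / 2; last by lra.
apply: nrm_multiplier_le; first lra.
exact: hL.
Qed.

End Completeness.

Section ActionCategory.
Context {R : realType} {Ob : Type} {C : cstarCategory R Ob}.
Context {Ix : Type} {f : Ix -> Ob}.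
Context {act : forall i j k : Ix, multiplier C (f j) (f k) ->
  arrow C (f i) (f j) -> arrow C (f i) (f k)}.
Context (actP : is_mult_action act).

Definition action_category : cstarData R Ix :=
  @CstarData R Ix (fun i j => multiplier C (f i) (f j))
    (fun i j k => @mult_comp R Ob C Ix f act actP i j k)
    (fun i j => @multiplier_star R Ob C (f i) (f j)).

(** Positivity is left as a hypothesis because the two instances prove it differently: over a single
    object [T] itself is the witness, over all of [Ob] a root of [T^* T] has to be found. *)
Lemma action_category_cstar :
  (forall i j (T : arrow action_category i j),
     positive_arrow (acomp (astar T) T)) ->
  is_cstar_category action_category.
Proof.
move=> pos; split=> //=.
- by move=> i j; apply: multiplier_complete => T b; exact: (nrm_multr actP).
- by move=> i j k S; exact: mult_comp_linear_right.
- by move=> i j k T; exact: mult_comp_linear_left.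
- by move=> *; exact: mult_compA.
- by move=> i j k S T; rewrite !nrmE -rmorphM lecR; exact: nrm_mult_comp.
- by move=> *; exact: multiplier_star_antilinear.
- by move=> i j T; rewrite !nrmE (nrm_multiplier_star actP).
- by move=> *; exact: multiplier_starK.
- by move=> *; exact: mult_comp_star.
- by move=> i j T; rewrite !nrmE nrm_mult_cstar rmorphXn.
Qed.

Lemma action_category_one i :
  @is_identity R Ix action_category i (multiplier_one C (f i)).
Proof.
split=> [j T|j T]; apply: multl_inj => a; rewrite multl_mult_comp.
  by rewrite (act_multl actP).
by apply: acomp_lcancel => c; rewrite (act_middle actP).
Qed.

End ActionCategory.

(** * The multiplier category *)

Section MultiplierAlgebra.
Context {R : realType} {Ob : Type} (C : cstarCategory R Ob) (rho : Ob).

Lemma multl_is_action : @is_mult_action R Ob C unit (fun=> rho)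
  (fun _ _ _ S t => multl S t).
Proof.
split=> _ _ _ S t; last exact: nrm_multl.
by move=> c; exact: (mult_middle (multiplierP S)).
Qed.

Lemma multiplier_algebra_cstar :
  is_cstar_category (action_category multl_is_action).
Proof. by apply: action_category_cstar => -[] [] T; exists T. Qed.

Definition multiplier_algebra : cstarCategory R unit :=
  CstarCategory multiplier_algebra_cstar.

Lemma multiplier_algebra_one :
  @is_identity R unit multiplier_algebra tt (multiplier_one C rho).
Proof. exact: (action_category_one multl_is_action tt). Qed.

Local Notation B := (endo multiplier_algebra_one).

Definition emb (t : arrow C rho rho) : B := multiplier_of C rho rho t.

Lemma embM s t : emb (acomp s t) = emb s * emb t.
Proof.
by apply: multl_inj => a; rewrite /emb multl_of -(acompA (cstarP C)).
Qed.

Lemma embB s t : emb (s - t) = emb s - emb t.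
Proof.
rewrite /emb addrC -scaleN1r multiplier_of_linear.
by rewrite scaleN1r addrC.
Qed.

Lemma adj_emb t : adj (emb t) = emb (astar t).
Proof. exact: multiplier_of_star. Qed.

Lemma nrm_emb t : nrm (emb t) = nrm t.
Proof. exact: nrm_multiplier_of. Qed.

Lemma approximate_unit_finite (l : seq (arrow C rho rho)) (e : R) : 0 < e ->
  exists u : arrow C rho rho, [/\ positive_arrow u, nrm u <= 1 &
    forall a, a \in l ->
      nrm (a - acomp u a) <= e /\ nrm (a - acomp a u) <= e].
Proof.
move=> e0; pose I (x : B) := exists t, x = emb t.
have [_ [[u ->] au nu hu]] : exists u, [/\ I u, adj u = u, nrm (u * u) <= 1 &
    forall a, a \in [seq emb a | a <- l] -> nrm (a - a * (u * u)) <= e /\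
                         nrm (a - (u * u) * a) <= e].
  apply: ideal_approximate_unit => //.
  - exists 0; apply: multl_inj => a.
    by rewrite /emb multl_of acomp0l.
  - move=> _ _ [s ->] [t ->]; exists (s + t).
    by have := multiplier_of_linear 1 s t; rewrite !scale1r.
  - move=> _ y [s ->]; exists (multr (y : multiplier C rho rho) s).
    exact: (etrans (mult_of_comp multl_is_action (i := tt) (j := tt) (k := tt) s y)
      (congr1 _ (ract_multr multl_is_action (i := tt) (j := tt) s y))).
  - move=> x _ [s ->]; exists (multl (x : multiplier C rho rho) s).
    exact: (mult_comp_of multl_is_action (i := tt) (j := tt) (k := tt)).
  - by move=> _ /mapP[a _ ->]; exists a.
have {}au : astar u = u.
  by apply: (@multiplier_of_inj _ _ C rho rho); rewrite -/(emb _) -adj_emb.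
exists (acomp u u); split.
- by exists u; rewrite au.
- by rewrite -nrm_emb embM.
- move=> a al; have [|h1 h2] := hu (emb a); first by rewrite map_f.
  by rewrite -!nrm_emb !embB !embM mulrA -[emb u * emb u * _]mulrA mulrA.
Qed.

(** No approximant is chosen for given [l] and [e]: all of them together form the sets of a filter
    base, since lists concatenate and tolerances have a minimum. They are nonempty by
    [approximate_unit_finite]. *)
Definition approximate_filter : set_system (arrow C rho rho) :=
  [set U | exists (l : seq (arrow C rho rho)) (e : R), 0 < e /\
    forall u, positive_arrow u -> nrm u <= 1 ->
    (forall a, a \in l ->
      nrm (a - acomp u a) <= e /\ nrm (a - acomp a u) <= e) -> U u].

Lemma approximate_filter_proper : ProperFilter approximate_filter.
Proof.
split.
  move=> [l [e [e0 h]]]; have [u [p n hu]] := approximate_unit_finite l e0.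
  exact: (h u).
split.
- by exists [::], 1; split.
- move=> P Q [l [e [e0 h]]] [m [d [d0 g]]].
  exists (l ++ m), (Num.min e d); rewrite lt_min e0 d0; split=> // u pu nu hu.
  split.
    apply: h => // a al; have [|h1 h2] := hu a; first by rewrite mem_cat al.
    by move: h1 h2; rewrite !le_min => /andP[-> _] /andP[-> _].
  apply: g => // a al; have [|h1 h2] := hu a; first by rewrite mem_cat al orbT.
  by move: h1 h2; rewrite !le_min => /andP[_ ->] /andP[_ ->].
- move=> P Q PQ [l [e [e0 h]]]; exists l, e; split=> // u pu nu hu.
  by apply/PQ/h.
Qed.

Lemma approximate_filterP : is_approximate_unit approximate_filter.
Proof.
have pF := approximate_filter_proper.
split=> //.
- exists [::], 1; split=> // u pu nu _; split=> //.
  by rewrite nrmE -(rmorph1 (real_complex R)) lecR.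
- move=> a; apply/cvg_nrmP => e e0; exists [:: a], (e / 2).
  split=> [|u _ _ /(_ a (mem_head _ _))[h _]]; first exact: divr_gt0.
  by apply: (le_lt_trans h); lra.
- move=> a; apply/cvg_nrmP => e e0; exists [:: a], (e / 2).
  split=> [|u _ _ /(_ a (mem_head _ _))[_ h]]; first exact: divr_gt0.
  by apply: (le_lt_trans h); lra.
Qed.

Lemma approximate_unitP : is_approximate_unit (@approximate_unit R Ob C rho).
Proof. by apply: xgetPex; exists approximate_filter; exact: approximate_filterP. Qed.

Lemma positive_adj (u : arrow C rho rho) : positive_arrow u -> astar u = u.
Proof.
by move=> [b ->]; rewrite (astar_comp (cstarP C)) (astarK (cstarP C)).
Qed.

Lemma approximate_unit_near : \forall u \near @approximate_unit R Ob C rho,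
  astar u = u /\ nrm u <= 1.
Proof.
have pF := approximate_unit_proper approximate_unitP.
apply: filterS (approximate_unit_positive approximate_unitP) => u [pu nu].
split; first exact: positive_adj.
by rewrite -lecR -nrmE.
Qed.

End MultiplierAlgebra.

(** * The action as a limit along approximate units *)

Section LimitAction.
Context {R : realType} {Ob : Type} (C : cstarCategory R Ob).
Implicit Types rho sigma tau : Ob.

Local Notation AU s := (@approximate_unit R Ob C s).

(** The unit of (sigma, sigma) is applied to [x = t t^*]. The square of the norm of [t - u t] is the
    norm of [(x - u x) - (x - u x) u], at most twice that of [x - u x]; hence the tolerance
    [e ^+ 2 / 2]. *)
Lemma approximate_unit_acomp rho sigma (t : arrow C rho sigma) (e : R) :
  0 < e -> \forall u \near AU sigma, nrm (t - acomp u t) < e.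
Proof.
move=> e0; have pF := approximate_unit_proper (approximate_unitP C sigma).
have d0 : 0 < e ^+ 2 / 2 by rewrite divr_gt0// exprn_gt0.
have /cvg_nrmP/(_ _ d0) h :=
  @approximate_unit_left _ _ _ _ _ (approximate_unitP C sigma) (acomp t (astar t)).
apply: filterS (filterI h (approximate_unit_near C sigma)) => u [] + [au nu].
set x := acomp t _ => hx.
rewrite -(@ltr_pXn2r _ 2) ?nnegrE ?nrm_ge0 ?ltW//.
rewrite -nrm_astar -nrm_cstar (astarK (cstarP C)).
have -> : acomp (t - acomp u t) (astar (t - acomp u t)) =
    (x - acomp u x) - acomp (x - acomp u x) u.
  rewrite astarB (astar_comp (cstarP C)) au acompBr (acompA (cstarP C)).
  by rewrite !acompBl -!(acompA (cstarP C)).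
apply: (le_lt_trans (nrmD _ _)); rewrite nrmN.
have := nrm_comp (x - acomp u x) u; have := nrm_ge0 (x - acomp u x); nra.
Qed.

(** Fix [v] with [v t] close to [t]. Then [(S u) t] is close to [(S u) (v t) = (S (u v)) t],
    uniformly in contractions [u], and [u v] tends to [v]; so the values are eventually near
    [(S v) t]. *)
Lemma multiplier_actl_cvg rho sigma tau (S : multiplier C sigma tau)
    (t : arrow C rho sigma) :
  acomp (multl S u) t @[u --> AU sigma] --> multiplier_actl S t.
Proof.
have pF := approximate_unit_proper (approximate_unitP C sigma).
suff : cvg (acomp (multl S u) t @[u --> AU sigma]) by [].
apply: (arrow_complete (cstarP C)); apply/nrm_cauchyP => e e0.
pose K := nrm S + 1; pose L := nrm t + 1.
have K1 : 0 < K by have := nrm_ge0 S; rewrite /K; lra.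
have L1 : 0 < L by have := nrm_ge0 t; rewrite /L; lra.
have d0 : 0 < e / 2 / K by rewrite !divr_gt0.
have l0 : 0 < e / 2 / K / L by rewrite divr_gt0.
have [v [hv [_ nv]]] :=
  filter_ex (filterI (approximate_unit_acomp t d0) (approximate_unit_near C sigma)).
exists (acomp (multl S v) t).
have /cvg_nrmP/(_ _ l0) h :=
  @approximate_unit_left _ _ _ _ _ (approximate_unitP C sigma) v.
apply: filterS (filterI h (approximate_unit_near C sigma)) => u [hu [_ nu]] /=.
have -> : acomp (multl S v) t - acomp (multl S u) t =
   acomp (multl S (v - acomp u v)) t - acomp (multl S u) (t - acomp v t).
  rewrite multlBr (multl_comp (multiplierP S)) acompBl acompBr.
  by rewrite (acompA (cstarP C)) opprB addrA subrK.
apply: (le_lt_trans (nrmD _ _)); rewrite nrmN.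
have h1 : nrm (acomp (multl S (v - acomp u v)) t) <= e / 2.
  apply: (le_trans (nrm_comp _ _)).
  apply: (@le_trans _ _ (K * (e / 2 / K / L) * L)); last first.
    by rewrite -mulrA divrK ?unitfE ?gt_eqF// mulrC divrK ?unitfE ?gt_eqF.
  apply: ler_pM; rewrite ?nrm_ge0//; last by rewrite lerDl.
  apply: (le_trans (nrm_multl _ _)); apply: ler_pM; rewrite ?nrm_ge0 ?ltW//.
  by rewrite ltrDl.
have h2 : nrm (acomp (multl S u) (t - acomp v t)) < e / 2.
  apply: (le_lt_trans (nrm_comp _ _)).
  apply: (@le_lt_trans _ _ (K * nrm (t - acomp v t))).
    rewrite ler_wpM2r ?nrm_ge0//; apply: (le_trans (nrm_multl _ _)).
    by have := nrm_ge0 S; have := nrm_ge0 u; rewrite /K; nra.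
  by rewrite mulrC -ltr_pdivlMr.
lra.
Qed.

(** For every [u], [c ((S u) t) = (c S) (u t)], and both sides converge. The norm bound survives the
    limit since [nrm u <= 1] eventually. *)
Lemma multiplier_actl_action : @is_mult_action R Ob C Ob id
  (fun rho sigma tau => @multiplier_actl R Ob C rho sigma tau).
Proof.
split=> rho sigma tau S t; have pF := approximate_unit_proper (approximate_unitP C sigma).
  move=> c; apply/eqP; rewrite -subr_eq0; apply/eqP.
  apply: (@nrm_le_eps _ _ _ (nrm c + nrm (multr S c))) => e e0.
  have /cvg_nrmP/(_ _ e0) h := @multiplier_actl_cvg _ _ _ S t.
  have [u [hu hu']] := filter_ex (filterI h (approximate_unit_acomp t e0)).
  have -> : acomp c (multiplier_actl S t) - acomp (multr S c) t =
     acomp c (multiplier_actl S t - acomp (multl S u) t)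
     - acomp (multr S c) (t - acomp u t).
    rewrite !acompBr !(acompA (cstarP C)) (mult_middle (multiplierP S)).
    by rewrite opprB addrA subrK.
  apply: (le_trans (nrmD _ _)); rewrite nrmN mulrDr lerD//;
    apply: (le_trans (nrm_comp _ _)); rewrite [leRHS]mulrC ler_wpM2l ?nrm_ge0//;
    exact: ltW.
apply/ler_addgt0Pr => e e0.
have /cvg_nrmP/(_ _ e0) h := @multiplier_actl_cvg _ _ _ S t.
have [u [hu [_ nu]]] := filter_ex (filterI h (approximate_unit_near C sigma)).
have := nrm_distD (multiplier_actl S t) (acomp (multl S u) t) 0.
rewrite !subr0 => /le_trans; apply; rewrite addrC lerD//; last exact: ltW.
apply: (le_trans (nrm_comp _ _)); rewrite ler_wpM2r ?nrm_ge0//.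
by apply: (le_trans (nrm_multl _ _)); rewrite ler_piMr ?nrm_ge0.
Qed.

Local Notation actP := multiplier_actl_action.

(** Along the approximate unit [u] is eventually self-adjoint, so [t (u T)] is the adjoint of
    [(T^* u) t^*], whose convergence is known. *)
Lemma multiplier_actrE rho sigma tau (t : arrow C sigma tau)
    (T : multiplier C rho sigma) :
  multiplier_actr t T =
  @ract _ _ C Ob id (@multiplier_actl R Ob C) rho sigma tau t T.
Proof.
have pF := approximate_unit_proper (approximate_unitP C sigma).
apply: cvg_lim => //; apply/cvg_nrmP => e e0.
have /cvg_nrmP/(_ _ e0) h :=
  @multiplier_actl_cvg _ _ _ (multiplier_star T) (astar t).
apply: filterS (filterI h (approximate_unit_near C sigma)) => u [+ [au _]].
rewrite -nrm_astar astarB (astar_comp (cstarP C)) (astarK (cstarP C)).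
by rewrite multl_star au (astarK (cstarP C)).
Qed.

Lemma multiplier_compE rho sigma tau (S : multiplier C sigma tau)
    (T : multiplier C rho sigma) :
  is_multiplier_comp S T (multiplier_comp S T) /\
  multiplier_comp S T = mult_comp actP S T.
Proof.
have h : is_multiplier_comp S T (mult_comp actP S T).
  by split=> // c; rewrite multiplier_actrE.
have h' : is_multiplier_comp S T (multiplier_comp S T).
  by apply: xgetPex; exists (mult_comp actP S T).
split=> //; apply: multl_inj => a.
by case: h' => -> _; case: h => -> _.
Qed.

Lemma multiplier_categoryE : multiplier_category C = action_category actP.
Proof.
rewrite /multiplier_category /action_category; congr CstarData.
apply/functional_extensionality_dep => rho.
apply/functional_extensionality_dep => sigma.
apply/functional_extensionality_dep => tau.
apply/funext => S; apply/funext => T.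
exact: (multiplier_compE S T).2.
Qed.

End LimitAction.

Section MultiplierCategory.
Context {R : realType} {Ob : Type} (C : cstarCategory R Ob).
Implicit Types rho sigma tau : Ob.

Local Notation actP := (multiplier_actl_action C).
Local Notation "S \c T" := (mult_comp actP S T) (at level 40).
Local Notation B rho := (endo (multiplier_algebra_one C rho)).

Lemma multiplier_algebra_mulE rho (x y : B rho) : x * y = x \c y.
Proof.
by apply: multl_inj => a; rewrite [RHS]multl_mult_comp (act_multl actP).
Qed.

(** The only appeal to the positivity axiom of [C]: it replaces [w] by an endomorphism, to which
    [psd_adjM] applies. *)
Lemma psd_emb rho sigma (w : arrow C rho sigma) :
  psd (emb (acomp (astar w) w) : B rho).
Proof.
have [b ->] := astar_comp_positive (cstarP C) w.
by rewrite embM -adj_emb; exact: psd_adjM.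
Qed.

(* Writing [z H z = - q^2] with [z] twice the negative part of [H = T^* T], the
   elements [a^* z H z a = (T z a)^* (T z a)] are positive by the axiom on arrows
   of [C], so that [q a = 0] for all [a]. *)
Lemma multiplier_star_comp_positive rho sigma (T : multiplier C rho sigma) :
  exists b : multiplier C rho rho,
    multiplier_star T \c T = multiplier_star b \c b.
Proof.
pose H : B rho := multiplier_star T \c T.
have aH : adj H = H.
  by rewrite /adj /H /= mult_comp_star multiplier_starK.
have [z [q [az aq zHz psdH]]] := sa_negative_part aH.
have qa0 (a : arrow C rho rho) : q * emb a = 0.
  pose w := multl T (multl (z : multiplier C rho rho) a).
  have hw : emb (acomp (astar w) w) = adj (emb a) * (z * H * z) * emb a.
    have Mw : multiplier_of C rho sigma w = T \c (z \c emb a).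
      by rewrite /emb !mult_comp_of /w -!(act_multl actP).
    rewrite !multiplier_algebra_mulE.
    have -> : emb (acomp (astar w) w) =
        multiplier_star (multiplier_of C _ _ w) \c multiplier_of C _ _ w.
      by rewrite multiplier_of_star mult_comp_of (act_of actP).
    rewrite Mw !mult_comp_star /H -!mult_compA.
    have -> : multiplier_star (z : multiplier C rho rho) = z by exact: az.
    by [].
  have p1 := psd_emb w; rewrite hw zHz mulrN mulNr in p1.
  have p2 : psd (adj (emb a) * (q * q) * emb a) by exact/psd_conj/psd_sqr.
  have := psd_anti p2 p1.
  have -> : adj (emb a) * (q * q) * emb a = adj (q * emb a) * (q * emb a).
    by rewrite adjM aq !mulrA.
  by move=> /(@star_comp_eq0 _ _ (multiplier_algebra C rho)).
have q0 : q = 0.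
  apply: multl_inj => a; apply: acomp_rcancel => a'.
  have := congr1 (fun Q : multiplier C rho rho => multl Q a') (qa0 a).
  rewrite multiplier_algebra_mulE multl_mult_comp multl_of (act_multl actP).
  by rewrite (multl_comp (multiplierP _)) acomp0l.
(* With [q = 0] the element [H] is positive, and its root in M(rho, rho) is the [b] sought. *)
have [|s [ps ss _]] := @psd_sqrt _ _ _ _ _ _ H.
  by apply: psdH; rewrite q0 mulr0.
exists s; rewrite -[LHS]/H -ss -[X in X * _](psd_adj ps).
by rewrite multiplier_algebra_mulE.
Qed.

Lemma multiplier_category_cstar : is_cstar_category (multiplier_category C).
Proof.
rewrite multiplier_categoryE; apply: action_category_cstar => rho sigma T.
exact: multiplier_star_comp_positive.
Qed.

Lemma multiplier_category_one rho :
  is_identity (D := multiplier_category C) (multiplier_one C rho).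
Proof.
have [hr hl] := action_category_one actP rho.
by split=> sigma T; rewrite /= (multiplier_compE _ _).2; [exact: hr | exact: hl].
Qed.

Lemma multiplier_of_id rho (e : arrow C rho rho) : is_identity e ->
  multiplier_of C rho rho e = multiplier_one C rho.
Proof. by move=> he; apply: multl_inj => a; rewrite multl_of he.2. Qed.

Lemma multiplier_of_monofunctor :
  is_cstar_monofunctor C (multiplier_category C) idfun (multiplier_of C).
Proof.
split; last by move=> rho sigma; exact: multiplier_of_inj.
split.
  split=> [rho sigma|rho sigma tau s t|rho sigma t].
  - exact: multiplier_of_linear.
  - by rewrite /= (multiplier_compE _ _).2 mult_comp_of (act_of actP).
  - by rewrite /= multiplier_of_star.
move=> _ _ rho e he; rewrite multiplier_of_id//.
exact: multiplier_category_one.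
Qed.

Lemma multiplier_ofB rho sigma (t u : arrow C rho sigma) :
  multiplier_of C _ _ (t - u) = multiplier_of C _ _ t - multiplier_of C _ _ u.
Proof.
by rewrite addrC -scaleN1r multiplier_of_linear scaleN1r addrC.
Qed.

(** An isometric image of a complete space is closed: the arrows [t] with [M_t] near [T] generate a
    Cauchy filter, and [T] is the image of its limit. *)
Lemma multiplier_of_closed rho sigma :
  closed (range (multiplier_of C rho sigma) : set (multiplier C rho sigma)).
Proof.
move=> T hT.
have approx e : 0 < e -> exists t, nrm (T - multiplier_of C rho sigma t) < e.
  rewrite -ltcR => /(nbhsx_ballx T)/hT[_ [[t _ <-] h]].
  by exists t; move: h; rewrite ball_nrm.
pose F : set_system (arrow C rho sigma) := [set U | exists e, 0 < e /\
  forall t, nrm (T - multiplier_of C _ _ t) < e -> U t].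
have FF : ProperFilter F.
  split; first by move=> [e [/approx[t ht] h]]; exact: h ht.
  split=> [|P Q [e [e0 h]] [d [d0 g]]|P Q PQ [e [e0 h]]].
  - by exists 1.
  - exists (Num.min e d); rewrite lt_min e0 d0; split=> // t.
    by rewrite lt_min => /andP[/h ? /g].
  - by exists e; split=> // t /h /PQ.
have : cvg F.
  apply: (arrow_complete (cstarP C)); apply/nrm_cauchyP => e e0.
  have e2 : 0 < e / 2 by rewrite divr_gt0.
  have [t ht] := approx _ e2; exists t, (e / 2); split=> // u hu.
  rewrite -nrm_multiplier_of multiplier_ofB.
  apply: (le_lt_trans (nrm_distD _ T _)); rewrite nrmB; lra.
move=> /cvg_ex[t ht]; exists t => //; apply/eqP; rewrite -subr_eq0; apply/eqP.
apply: nrm_le0; apply/ler_addgt0Pr => e e0; rewrite add0r.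
have e2 : 0 < e / 2 by rewrite divr_gt0.
have h : F [set u | nrm (t - u) < e / 2].
  exact: ((@cvg_nrmP _ _ _ F _ id t).2 ht _ e2).
have h' : F [set u | nrm (T - multiplier_of C _ _ u) < e / 2].
  by exists (e / 2).
have [u [/= hu hu']] := filter_ex (filterI h h').
apply: (le_trans (nrm_distD _ (multiplier_of C _ _ u) _)).
rewrite -multiplier_ofB nrm_multiplier_of [nrm (_ - T)]nrmB; lra.
Qed.

Lemma range_essential :
  is_essential_ideal (D := multiplier_category C)
    (fun rho sigma : Ob => range (multiplier_of C rho sigma)).
Proof.
split.
  split=> [rho sigma|rho sigma k _ _ [t _ <-] [u _ <-]|rho sigma|rho sigma _ [t _ <-]
          |rho sigma tau _ T [t _ <-]|rho sigma tau _ T [t _ <-]].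
  - by exists 0 => //; apply: multl_inj => a; rewrite multl_of acomp0l.
  - by exists (k *: t + u) => //; exact: multiplier_of_linear.
  - exact: multiplier_of_closed.
  - by exists (astar t) => //; rewrite /= multiplier_of_star.
  - rewrite /= (multiplier_compE _ _).2 mult_of_comp.
    by eexists.
  - rewrite /= (multiplier_compE _ _).2 mult_comp_of.
    by eexists.
move=> J hJ [rho [sigma [T [JT T0]]]].
(* A nonzero [T] in [J] has some nonzero [T a], and the multiplier of [T a] is [T] composed with
   that of [a], so it lies both in [J] and in the image of [C]. *)
have [a Ta] : exists a, multl T a <> 0.
  by apply/existsNP => h; apply: T0; apply: multl_inj => a; rewrite h.
exists rho, sigma => /seteqP[h _]; apply: Ta.
have := h (multiplier_of C rho sigma (multl T a)).
have -> : multiplier_of C rho sigma (multl T a) =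
    multiplier_comp T (multiplier_of C rho rho a).
  by rewrite (multiplier_compE _ _).2 mult_comp_of (act_multl actP).
have JTa := ideal_compr hJ (multiplier_of C rho rho a) JT.
move=> /(_ _) h'.
have : multiplier_comp T (multiplier_of C rho rho a) = 0.
  apply: h'; split=> //; exists (multl T a) => //.
  by rewrite (multiplier_compE _ _).2 mult_comp_of (act_multl actP).
rewrite (multiplier_compE _ _).2 mult_comp_of (act_multl actP) => h0.
apply: nrm0_eq0; rewrite -nrm_multiplier_of h0.
exact: nrm0.
Qed.

Lemma unital_range : cstar_unital C ->
  forall rho sigma, range (multiplier_of C rho sigma) = setT.
Proof.
move=> uC rho sigma; apply/seteqP; split=> // T _.
have [e he] := uC rho; exists (multl T e) => //.
apply: multl_inj => a.
by rewrite multl_of -(multl_comp (multiplierP T)) he.2.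
Qed.

End MultiplierCategory.

(** * Unital categories containing C as an essential ideal *)

Section Extension.
Context {R : realType} {Ob : Type} {C C' : cstarCategory R Ob}.
Context {J : forall rho sigma : Ob, arrow C rho sigma -> arrow C' rho sigma}.
Context (incJ : is_essential_ideal_inclusion J).
Implicit Types rho sigma tau : Ob.

Local Notation actP := (multiplier_actl_action C).

Let funJ : is_star_functor C C' idfun J. Proof. by case: incJ. Qed.

Let nrmJ rho sigma (t : arrow C rho sigma) : nrm (J t) = nrm t.
Proof. by case: incJ => _ h _; rewrite /nrm h. Qed.

Let idealJ : is_ideal (fun rho sigma => range (@J rho sigma)).
Proof. by case: incJ => _ _ []. Qed.

Let JZD rho sigma k (t u : arrow C rho sigma) : J (k *: t + u) = k *: J t + J u.
Proof. exact: (functor_linear funJ). Qed.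

Let J0 rho sigma : J (0 : arrow C rho sigma) = 0.
Proof. by apply: nrm0_eq0; rewrite nrmJ nrm0. Qed.

Let JM rho sigma tau (s : arrow C sigma tau) (t : arrow C rho sigma) :
  J (acomp s t) = acomp (J s) (J t).
Proof. exact: (functor_comp funJ). Qed.

Let Jstar rho sigma (t : arrow C rho sigma) : J (astar t) = astar (J t).
Proof. exact: (functor_star funJ). Qed.

Let J_inj rho sigma : injective (@J rho sigma).
Proof.
move=> t u h; apply/eqP; rewrite -subr_eq0; apply/eqP; apply: nrm0_eq0.
rewrite -nrmJ addrC -scaleN1r JZD scaleN1r h addrC subrr.
exact: nrm0.
Qed.

(** The inverse of [J] on its range; the default 0 never matters, as only products with an arrow of
    the ideal are pulled back. *)
Definition pullback rho sigma (y : arrow C' rho sigma) : arrow C rho sigma :=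
  xget 0 [set x | J x = y].

Let pullbackK rho sigma (y : arrow C' rho sigma) :
  range (@J rho sigma) y -> J (pullback y) = y.
Proof. by move=> [x _ hx]; apply: (@xgetPex _ 0 [set x | J x = y]); exists x. Qed.

Let pulll rho sigma tau (s : arrow C' sigma tau) (t : arrow C rho sigma) :
  J (pullback (acomp s (J t))) = acomp s (J t).
Proof. by apply: pullbackK; apply: (ideal_compl idealJ); exists t. Qed.

Let pullr rho sigma tau (t : arrow C sigma tau) (s : arrow C' rho sigma) :
  J (pullback (acomp (J t) s)) = acomp (J t) s.
Proof. by apply: pullbackK; apply: (ideal_compr idealJ); exists t. Qed.

Lemma restriction_subproof rho sigma (s : arrow C' rho sigma) :
  is_multiplier (fun a : arrow C rho rho => pullback (acomp s (J a)))
                (fun b : arrow C sigma sigma => pullback (acomp (J b) s)).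
Proof.
split.
- by move=> k a b; apply: J_inj; rewrite /= pulll !JZD !pulll acompDr acompZr.
- exists (nrm s)%:C%C => a; rewrite !nrmE -rmorphM lecR -nrmJ pulll -(nrmJ a).
  exact: nrm_comp.
- by move=> a a'; apply: J_inj; rewrite /= pulll !JM pulll (acompA (cstarP C')).
- by move=> k a b; apply: J_inj; rewrite /= pullr !JZD !pullr acompDl acompZl.
- exists (nrm s)%:C%C => b; rewrite !nrmE -rmorphM lecR -nrmJ pullr -(nrmJ b).
  by rewrite mulrC; exact: nrm_comp.
- by move=> b' b; apply: J_inj; rewrite /= pullr !JM pullr (acompA (cstarP C')).
- by move=> a b; apply: J_inj; rewrite !JM pulll pullr (acompA (cstarP C')).
Qed.

Definition restriction rho sigma (s : arrow C' rho sigma) :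
  multiplier C rho sigma := mk_multiplier (restriction_subproof s).

(** The limit defining the action is computed by the product in [C'], which makes [restriction]
    multiplicative. *)
Let act_restriction rho sigma tau (s : arrow C' sigma tau)
    (t : arrow C rho sigma) :
  multiplier_actl (restriction s) t = pullback (acomp s (J t)).
Proof.
apply: acomp_lcancel => c; rewrite (act_middle actP); apply: J_inj.
by rewrite !JM pulll pullr (acompA (cstarP C')).
Qed.

(* The arrows annihilating the ideal on the right form an ideal that meets it
   only in zero. *)
Let annihilator rho sigma : set (arrow C' rho sigma) :=
  [set s | forall tau (t : arrow C tau rho), acomp s (J t) = 0].

Let annihilator_ideal : is_ideal annihilator.
Proof.
have cC := cstarP C'.
split.
- by move=> rho sigma tau t; rewrite acomp0l.
- by move=> rho sigma k s u hs hu tau t; rewrite acompDl acompZl hs hu scaler0 addr0.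
- move=> rho sigma s hs tau t.
  apply: (@nrm_le_eps _ _ _ (nrm (J t))) => e.
  rewrite -ltcR => /(nbhsx_ballx s)/hs[u [hu]]; rewrite ball_nrm => su.
  have -> : acomp s (J t) = acomp (s - u) (J t) by rewrite acompBl hu subr0.
  by apply: (le_trans (nrm_comp _ _)); rewrite ler_wpM2r ?nrm_ge0// ltW.
(* For [x = s^* (J t)] one has [x^* x = (J t)^* s x], and [x] lies in the ideal, so [s] kills it. *)
- move=> rho sigma s hs tau t; apply: star_comp_eq0.
  rewrite (astar_comp cC) (astarK cC) -(acompA cC) -pulll hs.
  by rewrite acomp0r.
- move=> rho sigma tau s u hs xi t.
  by rewrite -(acompA cC) -pulll hs.
- by move=> rho sigma tau s u hs xi t; rewrite -(acompA cC) hs acomp0r.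
Qed.

(** Put [d = s - s']. It kills [J a] for endomorphisms [a], hence every [y = J t], because [d y]
    times its adjoint is [d y y^* d^*] and [y y^*] is such a [J a]. So [d] is in the annihilator.
    This meets the ideal in zero only, since [J u] times its adjoint vanishes for [J u] there, and
    essentiality gives [d = 0]. *)
Lemma restriction_inj rho sigma : injective (@restriction rho sigma).
Proof.
have cC := cstarP C'.
move=> s s' h; apply: contrapT => ss'.
case: incJ => _ _ [_ /(_ _ annihilator_ideal)[]].
  exists rho, sigma, (s - s'); split; last first.
    by move=> /eqP; rewrite subr_eq0 => /eqP.
  have ha (a : arrow C rho rho) : acomp (s - s') (J a) = 0.
    have /(congr1 (fun T => J (multl T a))) := h.
    by rewrite /multl /= !pulll acompBl => ->; rewrite subrr.
  move=> tau t; suff h0 : astar (acomp (s - s') (J t)) = 0.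
    by rewrite -[LHS](astarK cC) h0 astar0.
  apply: star_comp_eq0; rewrite (astarK cC) (astar_comp cC).
  by rewrite -Jstar (acompA cC) -[acomp (acomp _ (J t)) _](acompA cC) -JM ha acomp0l.
move=> xi [tau]; apply; apply/seteqP; split=> [_ [[u _ <-] hu]|_ ->]; last first.
  by split; [exists 0; rewrite ?J0 | exact: (ideal0 annihilator_ideal)].
have h0 : astar (J u) = 0.
  by apply: star_comp_eq0; rewrite (astarK cC) -Jstar; exact: hu.
by apply: nrm0_eq0; rewrite -nrm_astar h0 nrm0.
Qed.

Lemma restriction_monofunctor :
  is_cstar_monofunctor C' (multiplier_category C) idfun restriction.
Proof.
have cC := cstarP C'.
split; last exact: restriction_inj.
split.
  split=> [rho sigma k s u|rho sigma tau s t|rho sigma s].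
  - apply: multl_inj => a; apply: J_inj.
    by rewrite multlD multlZ JZD /multl /= !pulll acompDl acompZl.
  - rewrite /= (multiplier_compE _ _).2; apply: multl_inj => a.
    rewrite multl_mult_comp act_restriction.
    by apply: J_inj; rewrite /multl /= !pulll (acompA cC).
  - apply: multl_inj => b; rewrite multl_star; apply: J_inj.
    rewrite Jstar /multl /multr /= pulll pullr Jstar.
    by rewrite (astar_comp cC) (astarK cC).
move=> _ _ rho e he.
have -> : restriction e = multiplier_one C rho; last exact: multiplier_category_one.
by apply: multl_inj => a; apply: J_inj; rewrite /multl /= pulll he.2.
Qed.

Lemma restriction_of rho sigma (t : arrow C rho sigma) :
  restriction (J t) = multiplier_of C rho sigma t.
Proof.
by apply: multl_inj => a; apply: J_inj; rewrite multl_of JM /multl /= pulll.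
Qed.

End Extension.

Unset Implicit Arguments.

Theorem proposition2p2 (R : realType) (Ob : Type) (C : cstarCategory R Ob) :
  [/\ forall (rho sigma tau : Ob) (S : multiplier C sigma tau)
        (T : multiplier C rho sigma),
        is_multiplier_comp S T (multiplier_comp S T),
      is_cstar_category (multiplier_category C),
      forall rho : Ob,
        is_identity (D := multiplier_category C) (multiplier_one C rho) &
      cstar_unital (multiplier_category C)] /\
  is_cstar_monofunctor C (multiplier_category C) idfun (multiplier_of C) /\
  is_essential_ideal (D := multiplier_category C)
    (fun rho sigma : Ob => range (@multiplier_of R Ob C rho sigma)) /\
  (cstar_unital C ->
   forall rho sigma : Ob, range (@multiplier_of R Ob C rho sigma) = setT) /\
  (forall (C' : cstarCategory R Ob)
     (J : forall rho sigma : Ob, arrow C rho sigma -> arrow C' rho sigma),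
     cstar_unital C' ->
     is_essential_ideal_inclusion J ->
     exists I' : forall rho sigma : Ob, arrow C' rho sigma ->
         arrow (multiplier_category C) rho sigma,
       is_cstar_monofunctor C' (multiplier_category C) idfun I' /\
       forall (rho sigma : Ob) (t : arrow C rho sigma),
         I' rho sigma (J rho sigma t) = multiplier_of C rho sigma t).
Proof.
split.
  split=> [rho sigma tau S T|||rho].
  - exact: (multiplier_compE S T).1.
  - exact: multiplier_category_cstar.
  - exact: multiplier_category_one.
  - by exists (multiplier_one C rho); exact: multiplier_category_one.
split; first exact: multiplier_of_monofunctor.
split; first exact: range_essential.
split; first exact: unital_range.
move=> C' J _ incJ; exists (@restriction R Ob C C' J incJ).
split; first exact: restriction_monofunctor.
by move=> rho sigma t; exact: restriction_of.
Qed.
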